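(* Let $X$ and $Y$ be Banach spaces, $\Omega\subset X$, $F:X\rightrightarrows Y$, $\bar x\in\Omega$, $\bar y\in F(\bar x)$, and let $\Xi$ be a nonempty family of subsets of $Y$. Suppose that the sets $\Omega$, $\mathrm{gph}\,F$ and all members of $\Xi$ are closed. If the triple $\{F,\Omega,\Xi\}$ is approximately stationary at $(\bar x,\bar y)$, then, for any $\varepsilon>0$, there exist $(x_1,y_1)\in\mathrm{gph}\,F\cap B_{\varepsilon}(\bar x,\bar y)$, $x_2\in\Omega\cap B_{\varepsilon}(\bar x)$, $A\in\Xi$, $y_2\in A\cap B_\varepsilon(\bar y)$, $(x_1^*,y_1^* )\in N^C_{\mathrm{gph}\,F}(x_1,y_1)$, $x_2^*\in N^C_\Omega(x_2)$ and $y_2^*\in N^C_{A}(y_2)$ such that $$\|(x_1^*,y_1^* )+(x_2^*,y_2^* )\|<\varepsilon\quad\text{and}\quad \|(x_1^*,y_1^* )\|+\|(x_2^*,y_2^* )\|=1.$$ If $X$ and $Y$ are Asplund and the triple $\{F,\Omega,\Xi\}$ is approximately stationary at $(\bar x,\bar y)$, then, for any $\varepsilon>0$, there exist $(x_1,y_1)\in\mathrm{gph}\,F\cap B_{\varepsilon}(\bar x,\bar y)$, $x_2\in\Omega\cap B_{\varepsilon}(\bar x)$, $A\in\Xi$, $y_2\in A\cap B_\varepsilon(\bar y)$, $(x_1^*,y_1^* )\in N^F_{\mathrm{gph}\,F}(x_1,y_1)$, $x_2^*\in N^F_\Omega(x_2)$ and $y_2^*\in N^F_{A}(y_2)$ such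 that $$\|(x_1^*,y_1^* )+(x_2^*,y_2^* )\|<\varepsilon\quad\text{and}\quad \|(x_1^*,y_1^* )\|+\|(x_2^*,y_2^* )\|=1.$$
   Context: Notation: $B_\delta(x)$ is the open ball; $X\times Y$ carries the maximum norm, its dual $X^*\times Y^*$ the corresponding dual norm $\|(x^*,y^* )\|=\|x^*\|+\|y^*\|$; $\mathbb B$ denotes the open unit ball; $d(x,S)=\inf_{u\in S}\|u-x\|$ with $d(x,\emptyset)=+\infty$; $\mathrm{gph}\,F=\{(x,y)\mid y\in F(x)\}$ for a set-valued mapping $F$ (values may be empty). Normal cones: for a subset $S$ of a normed space $Z$ and $\bar z\in S$, the Fréchet normal cone is $N^F_S(\bar z)=\{z^*\in Z^*\mid \limsup_{S\ni z\to\bar z,\,z\ne\bar z}\langle z^*,z-\bar z\rangle/\|z-\bar z\|\le0\}$; the Clarke tangent cone $T^C_S(\bar z)$ is the set of $w\in Z$ such that for all $z_k\to\bar z$ with $z_k\in S$ and all $t_k\downarrow0$ there are $w_k\to w$ with $z_k+t_kw_k\in S$ for all $k$; the Clarke normal cone is $N^C_S(\bar z)=\{z^*\in Z^*\mid\langle z^*,w\rangle\le0\ \forall w\in T^C_S(\bar z)\}$. Both are empty by convention if $\bar z\notin S$. A Banach space is Asplund if the dual of each of its separable subspaces is separable. Approximate stationarity: a collection $\{\Xi_1,\ldots,\Xi_n\}$ of families of subsets of a normed space $Z$ is approximately stationary at $\bar z\in Z$ if, for any $\varepsilon>0$, there exist $\rho\in(0,\varepsilon)$, $A_i\in\Xi_i$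 and $z_i\in B_\varepsilon(\bar z)$ $(i=1,\ldots,n)$ such that $\max_{1\le i\le n}d(z_i,A_i)<\varepsilon\rho$ and $\bigcap_{i=1}^n(A_i-z_i)\cap(\rho\mathbb B)=\emptyset$. The triple $\{F,\Omega,\Xi\}$ is approximately stationary at $(\bar x,\bar y)$ if the pair of families $\Xi_1:=\{\mathrm{gph}\,F\}$, $\Xi_2:=\{\Omega\times A\mid A\in\Xi\}$ of subsets of $X\times Y$ is approximately stationary at $(\bar x,\bar y)$. *)

(* Defs.v *)
From HB Require Import structures.
From mathcomp Require Import all_boot all_order all_algebra.
From mathcomp Require Import all_classical all_reals all_analysis.
Import Order.TTheory GRing.Theory Num.Theory.
Import numFieldNormedType.Exports.

Set Implicit Arguments.
Unset Strict Implicit.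
Unset Printing Implicit Defensive.

Local Open Scope classical_set_scope.
Local Open Scope ring_scope.

Section Dual.
Context {R : realType}.

Record dual (Z : normedModType R) := Dual {
  dual_fun :> {linear Z -> R^o};
  dual_continuous : continuous dual_fun }.

(* Stated for arbitrary functions and relative to a set [E], so that it also
   serves for the dual of a subspace; the supremum is the operator norm when
   [f] is linear and continuous on the subspace [E]. *)
Definition dual_norm_on (Z : normedModType R) (E : set Z) (f : Z -> R) : R :=
  sup [set `|f z| | z in E `&` [set z | `|z| <= 1]].

Definition dual_norm (Z : normedModType R) (f : Z -> R) : R :=
  dual_norm_on setT f.

Definition dual_pair_fun (X Y : normedModType R) (f : dual X) (g : dual Y)
  (z : X * Y) : R^o := f z.1 + g z.2.

Lemma dual_pair_linear (X Y : normedModType R) (f : dual X) (g : dual Y) :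
  linear (dual_pair_fun f g).
Proof.
by move=> a [x y] [x' y']; rewrite /dual_pair_fun /= !linearP scalerDr addrACA.
Qed.

HB.instance Definition _ (X Y : normedModType R) (f : dual X) (g : dual Y) :=
  GRing.isLinear.Build R (X * Y)%type R^o *:%R (dual_pair_fun f g)
    (dual_pair_linear f g).

Lemma dual_pair_continuous (X Y : normedModType R) (f : dual X) (g : dual Y) :
  continuous (dual_pair_fun f g).
Proof.
move=> z; apply: cvgD.
  by apply: continuous_comp; [exact: cvg_fst|exact: dual_continuous].
by apply: continuous_comp; [exact: cvg_snd|exact: dual_continuous].
Qed.

(* The element of (X * Y)^* represented by (f, g), with
   <(f, g), (x, y)> = <f, x> + <g, y>. *)
Definition dual_pair (X Y : normedModType R) (f : dual X) (g : dual Y) :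
  dual (X * Y)%type := Dual (@dual_pair_continuous X Y f g).

(* The norm on X^* * Y^* dual to the maximum norm on X * Y
   (see [dual_norm_dual_pair] below). *)
Definition pair_norm (X Y : normedModType R) (f : X -> R) (g : Y -> R) : R :=
  dual_norm f + dual_norm g.

Lemma dual_has_sup (Z : normedModType R) (f : dual Z) :
  has_sup [set `|f z| | z in setT `&` [set z | `|z| <= 1]].
Proof.
split; first by exists `|f 0|; exists 0 => //; split => //=; rewrite normr0.
have /linear_boundedP : bounded_near f (nbhs (0 : Z)).
  exact/linear_bounded_continuous/dual_continuous.
case=> M [_ /(_ (`|M| + 1)) Mf].
have {}Mf z := Mf (ltr_pwDr ltr01 (ler_norm M)) z.
exists (`|M| + 1) => _ [z [_ /= z1] <-].
by rewrite (le_trans (Mf z))// ler_piMr// addr_ge0.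
Qed.

Lemma dual_norm_ub (Z : normedModType R) (f : dual Z) z :
  `|z| <= 1 -> `|f z| <= dual_norm f.
Proof. by move=> z1; apply: (sup_upper_bound (dual_has_sup f)); exists z. Qed.

Lemma dual_norm_dual_pair (X Y : normedModType R) (f : dual X) (g : dual Y) :
  dual_norm (dual_pair f g) = pair_norm f g.
Proof.
apply/eqP; rewrite eq_le; apply/andP; split.
  apply: ge_sup; first exact: (dual_has_sup (dual_pair f g)).1.
  move=> _ [[x y] [_ /= xy1] <-].
  move: xy1; rewrite prod_normE/= ge_max => /andP[x1 y1].
  by rewrite (le_trans (ler_normD _ _))// lerD// dual_norm_ub.
rewrite /pair_norm /dual_norm /dual_norm_on -sup_sumE; [|exact: dual_has_sup..].
apply: ge_sup.
  have [[a Ha] _] := dual_has_sup f; have [[b Hb] _] := dual_has_sup g.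
  by exists (a + b), a => //; exists b.
move=> _ [_ [x [_ /= x1] <-]] [_ [y [_ /= y1] <-] <-].
have sgle (Z : normedModType R) (h : dual Z) z :
    `|z| <= 1 -> `|Num.sg (h z) *: z| <= 1.
  by move=> z1; rewrite normrZ normr_sg; case: eqP => _;
    rewrite ?mul0r ?mul1r// ler01.
have sgE (Z : normedModType R) (h : dual Z) z :
    h (Num.sg (h z) *: z) = `|h z|.
  by rewrite linearZ/= [RHS]normrEsg.
have -> : `|f x| + `|g y| =
    `|dual_pair f g (Num.sg (f x) *: x, Num.sg (g y) *: y)|.
  by rewrite /= /dual_pair_fun/= !sgE [RHS]ger0_norm// addr_ge0.
by apply: dual_norm_ub; rewrite prod_normE/= ge_max !sgle.
Qed.

End Dual.

Section NormalCones.
Context {R : realType} {Z : normedModType R}.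
Implicit Types (S : set Z) (zb : Z).

Definition frechet_normal S zb : set (dual Z) :=
  [set f | S zb /\
    (limf_esup (fun z => (f (z - zb) / `|z - zb|)%:E) (within S zb^') <= 0)%E].

(* t_k \downarrow 0 is read as t_k > 0 and t_k --> 0. *)
Definition clarke_tangent S zb : set Z :=
  [set w | forall (z : Z^nat) (t : R^nat),
    (forall k, S (z k)) -> z @ \oo --> zb ->
    (forall k, 0 < t k) -> t @ \oo --> (0 : R) ->
    exists2 v : Z^nat, v @ \oo --> w & forall k, S (z k + t k *: v k)].

Definition clarke_normal S zb : set (dual Z) :=
  [set f | S zb /\ forall w, clarke_tangent S zb w -> f w <= 0].

End NormalCones.

Section Asplund.
Context {R : realType} {X : normedModType R}.
Implicit Types (E : set X).

Definition linear_subspace E :=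
  E 0 /\ forall (a : R) x y, E x -> E y -> E (a *: x + y).

Definition separable_set E :=
  exists D : set X, [/\ countable D, D `<=` E & E `<=` closure D].

(* An element of the dual of the subspace [E] is represented by a function on
   the whole space of which only the values on [E] matter. *)
Definition subspace_dual E : set (X -> R) :=
  [set f | (forall (a : R) x y, E x -> E y ->
             f (a *: x + y) = a * f x + f y) /\
           {within E, continuous f}].

Definition separable_subspace_dual E :=
  exists D : set (X -> R), [/\ countable D, D `<=` subspace_dual E &
    forall f, subspace_dual E f -> forall e, 0 < e ->
      exists2 g, D g & dual_norm_on E (f \- g) < e].

End Asplund.

Definition asplund (R : realType) (X : completeNormedModType R) :=
  forall E : set X, linear_subspace E -> separable_set E ->
    separable_subspace_dual E.

Section Stationarity.
Context {R : realType}.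

Definition set_dist (Z : normedModType R) (z : Z) (A : set Z) : \bar R :=
  ereal_inf [set (`|u - z|)%:E | u in A].

Definition approx_stationary (Z : normedModType R) (n : nat)
    (Xi : 'I_n -> set (set Z)) (zb : Z) :=
  forall e : R, 0 < e ->
    exists (rho : R) (A : 'I_n -> set Z) (z : 'I_n -> Z),
    [/\ 0 < rho < e,
        forall i, Xi i (A i),
        forall i, ball zb e (z i),
        (\big[maxe/-oo]_(i < n) set_dist (z i) (A i) < (e * rho)%:E)%E &
        (\bigcap_i [set a - z i | a in A i]) `&` ball 0 rho = set0].

Definition gph (X Y : Type) (F : X -> set Y) : set (X * Y) :=
  [set z | F z.1 z.2].

Definition triple_approx_stationary (X Y : normedModType R) (F : X -> set Y)
    (Omega : set X) (Xi : set (set Y)) (xb : X) (yb : Y) :=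
  @approx_stationary (X * Y)%type 2
    (fun i => if i == ord0 then [set gph F]
              else [set Omega `*` A | A in Xi])
    (xb, yb).

End Stationarity.

(* Main.v *)
Require Import Defs.
From HB Require Import structures.
From mathcomp Require Import all_boot all_order all_algebra.
From mathcomp Require Import all_classical all_reals all_analysis.
From mathcomp Require Import lra ring.
Import Order.TTheory GRing.Theory Num.Theory.
Import numFieldNormedType.Exports.
Set Implicit Arguments.
Unset Strict Implicit.
Unset Printing Implicit Defensive.
Local Open Scope classical_set_scope.
Local Open Scope ring_scope.

(** Let [z_0], [z_1], [rho] and [A] be given by approximate stationarity, and let
    [S = gph F * (Omega * A)]. On [S], the function
    [theta (u, v) = |(u - v) - (z_0 - z_1)|] does not vanish at distance less than
    [rho] from [(z_0, z_1)], but it is of order [eps * rho] at some point. By a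
    variational principle, [theta] plus a perturbation of slope [tau = O(eps)] has a
    minimum on [S] at a nearby point [w]. As [theta] only depends on
    [J (u, v) = (u - v, 0)], this yields a normal [f] to [S] at [w] dominated by
    [2 |J x| + tau |x|], so that the two components of [f] almost cancel, and
    bounded below in the direction in which [theta] decreases, so that they are
    not small; it remains to normalize [f].

    For Clarke normals, [f] comes from a sandwich theorem of Mazur-Orlicz type
    applied to the tangent cone. For Frechet normals in Asplund spaces, one works
    in a separable subspace [E], whose dual is separable: there the norm in [theta]
    is replaced by the square root of a Frechet smooth gauge [Q], the conjugate of
    a sum of squares of dual seminorms, and [f] is obtained on [E] by
    differentiation. The subspace [E] is closed under the choice of finite
    certificates that no normal functional exists in the whole space, so [f] lifts
    from [E] by the Mazur-Orlicz theorem. *)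

(** * Sandwich theorems *)

Section HahnBanach.
Context {R : realType} {V : lmodType R}.
Implicit Types (p q : V -> R) (T : set (V * R)).

(** The obstacle is the Frechet case. Minimality yields a Frechet normal only by differentiating,
    and an Asplund space need not carry a differentiable norm. A separable subspace with separable
    dual does carry a smooth gauge, but a Hahn-Banach extension of the functional found there is
    normal only to the part of [S] inside the subspace. Hence the existence of a normal in the whole
    space is restated as the absence of finite certificates: a certificate consists of finitely many
    points and numbers, so a countable set can contain a copy of each one that matters.

    That [f] is not small is expressed by a lower bound at a single vector [H]. A lower bound on the
    norm would not be a condition of Mazur-Orlicz type, whereas [kappa * |H| <= f H] is one, and it
    can be imposed together with the inequalities that define a normal.

    Stationarity supplies an almost minimal value of order [eps * rho] and a radius of order [rho],
    so the slope of the perturbation is of order [eps] whatever [rho] is. *)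

Definition sublinear p :=
  (forall x y, p (x + y) <= p x + p y) /\
  (forall (t : R) x, 0 <= t -> p (t *: x) = t * p x).

Lemma sublinear0 p : sublinear p -> p 0 = 0.
Proof. by case=> _ /(_ 0 0 (lexx 0)); rewrite scale0r mul0r. Qed.

Lemma sublinearN p x : sublinear p -> - p (- x) <= p x.
Proof.
by move=> hp; rewrite lerNl -subr_ge0 opprK -(sublinear0 hp) -(addNr x) hp.1.
Qed.

(** Take for [q x] the infimum of [p (x + t.1) - t.2] over [T]. It is finite, being at least
    [- p (- x)]. A linear minorant of [q] is then at least [t.2] at [t.1], so the constraints of [T]
    are absorbed into the bound. *)
Lemma sublinear_cone_inf p T :
  sublinear p -> T (0, 0) ->
  (forall s t, T s -> T t -> T (s + t)) ->
  (forall (a : R) t, 0 < a -> T t -> T (a *: t.1, a * t.2)) ->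
  (forall t, T t -> t.2 <= p t.1) ->
  exists q, [/\ sublinear q, forall x, q x <= p x &
    forall t, T t -> q (- t.1) <= - t.2].
Proof.
move=> hp T0 TD TZ Tp.
pose A x := [set p (x + t.1) - t.2 | t in T].
have hA x : has_inf (A x).
  split; first by exists (p (x + 0) - 0), (0, 0).
  exists (- p (- x)) => _ [t Tt <-].
  have := hp.1 (x + t.1) (- x); rewrite addrC addKr.
  have := Tp _ Tt; lra.
pose q x := inf (A x).
have qle x t : T t -> q x <= p (x + t.1) - t.2.
  by move=> Tt; apply: (ge_inf (hA x).2); exists t.
have lbq x c : (forall t, T t -> c <= p (x + t.1) - t.2) -> c <= q x.
  by move=> h; apply: lb_le_inf (hA x).1 _ => _ [t Tt <-]; exact: h.
have qZ (a : R) x : 0 < a -> a * q x <= q (a *: x).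
  move=> a0; apply: (lbq _) => t Tt.
  have ai : 0 < a^-1 by rewrite invr_gt0.
  have := qle x _ (TZ _ _ ai Tt); rewrite -(ler_pM2l a0) => /le_trans; apply.
  rewrite mulrBr mulrA divff ?gt_eqF// mul1r -(hp.2 _ _ (ltW a0)).
  by rewrite scalerDr scalerA divff ?gt_eqF// scale1r.
exists q; split; last by move=> t /(qle (- t.1)); rewrite addNr (sublinear0 hp) add0r.
- split.
  + move=> x y; rewrite -lerBlDr; apply: (lbq _) => s Ts; rewrite lerBlDr -lerBlDl.
    apply: (lbq _) => t Tt; rewrite lerBlDl.
    apply: le_trans (qle (x + y) _ (TD _ _ Ts Tt)) _ => /=.
    by have := hp.1 (x + s.1) (y + t.1); rewrite addrACA; lra.
  + move=> a x; rewrite le_eqVlt => /orP[/eqP <-|a0].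
      rewrite scale0r mul0r; apply/eqP; rewrite eq_le; apply/andP; split.
        by have := qle 0 _ T0; rewrite addr0 subr0 (sublinear0 hp).
      by apply: (lbq _) => t Tt; rewrite add0r subr_ge0 Tp.
    apply/eqP; rewrite eq_le qZ// andbT.
    have ai : 0 < a^-1 by rewrite invr_gt0.
    have := qZ _ (a *: x) ai; rewrite scalerA mulVf ?gt_eqF// scale1r.
    by rewrite -(ler_pM2l a0) mulrA divff ?gt_eqF// mul1r.
- by move=> x; have := qle x _ T0; rewrite addr0 subr0.
Qed.

(** Zorn's lemma on the sublinear minorants of [p], ordered downwards; the lower bound [- p (- x)]
    makes the pointwise infimum of a chain finite. *)
Lemma sublinear_minimal p : sublinear p ->
  exists q, [/\ sublinear q, forall x, q x <= p x &
    forall q', sublinear q' -> (forall x, q' x <= q x) -> forall x, q x <= q' x].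
Proof.
move=> hp; pose D := {q | sublinear q /\ forall x, q x <= p x}.
pose le (q q' : D) := `[< forall x, sval q' x <= sval q x >].
have p0 : D by exists p; split.
have [| | |[q [hq qp]] qmin] := ZL_preorder p0 (R := le).
- by move=> t; apply/asboolP.
- by move=> r s t /asboolP h /asboolP h'; apply/asboolP => x; exact: le_trans (h' x) (h x).
- move=> A Atot; have [[a0 Aa0]|Ae] := pselect (exists a, A a); last first.
    by exists p0 => s As; exfalso; apply: Ae; exists s.
  pose B x := [set sval q x | q in A].
  have hB x : has_inf (B x).
    split; first by exists (sval a0 x), a0.
    exists (- p (- x)) => _ [[q [hq qp]] Aq <-] /=.
    by apply: le_trans (sublinearN x hq); rewrite lerN2.
  pose i x := inf (B x).
  have ile x (q : D) : A q -> i x <= sval q x.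
    by move=> Aq; apply: (ge_inf (hB x).2); exists q.
  have lei x c : (forall q : D, A q -> c <= sval q x) -> c <= i x.
    by move=> h; apply: lb_le_inf (hB x).1 _ => _ [q Aq <-]; exact: h.
  have hi : sublinear i.
    split=> [x y|a x a0'].
      rewrite -lerBlDr; apply: (lei _) => q Aq; rewrite lerBlDr -lerBlDl.
      apply: (lei _) => q' Aq'; rewrite lerBlDl.
      (* Subadditivity of the infimum needs a single member of the chain below both [q] and [q'];
         comparability provides it. *)
      have [/asboolP h|/asboolP h] := Atot _ _ Aq Aq'.
        apply: le_trans (ile _ _ Aq') _; apply: le_trans ((svalP q').1.1 _ _) _.
        by rewrite lerD2r.
      apply: le_trans (ile _ _ Aq) _; apply: le_trans ((svalP q).1.1 _ _) _.
      by rewrite lerD2l.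
    move: a0'; rewrite le_eqVlt => /orP[/eqP <-|a0'].
      rewrite scale0r mul0r; apply/eqP; rewrite eq_le; apply/andP; split.
        by apply: le_trans (ile _ _ Aa0) _; rewrite (sublinear0 (svalP a0).1).
      by apply: (lei _) => q _; rewrite (sublinear0 (svalP q).1).
    apply/eqP; rewrite eq_le; apply/andP; split.
      rewrite -ler_pdivrMl//; apply: (lei _) => q Aq.
      rewrite ler_pdivrMl// -((svalP q).1.2 _ _ (ltW a0')); exact: ile.
    by apply: (lei _) => q Aq; rewrite ((svalP q).1.2 _ _ (ltW a0')) ler_pM2l// ile.
  have ip x : i x <= p x by apply: le_trans (ile x _ Aa0) ((svalP a0).2 x).
  exists (exist _ i (conj hi ip)) => s As; apply/asboolP => x /=; exact: ile.
exists q; split=> // q' hq' q'q.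
have q'p x : q' x <= p x by apply: le_trans (qp x).
have h : le (exist _ q (conj hq qp)) (exist _ q' (conj hq' q'p)) by apply/asboolP.
by move: (qmin _ h) => /asboolP.
Qed.

(* A minimal sublinear functional is linear. *)
Lemma sublinear_minorant_linear p : sublinear p ->
  exists f : {linear V -> R^o}, forall x, f x <= p x.
Proof.
move=> /sublinear_minimal[q [hq qp qmin]].
have qN y : q (- y) = - q y.
  apply/eqP; rewrite eq_le; apply/andP; split; last first.
    by have := sublinearN (- y) hq; rewrite opprK.
  (* Along the ray generated by [(y, q y)], [sublinear_cone_inf] gives a sublinear [q' <= q] with
     [q' (- y) <= - q y]; by minimality [q] lies below [q']. *)
  pose T := [set t : V * R | exists2 a, 0 <= a & t = (a *: y, a * q y)].
  have [] := @sublinear_cone_inf q T hq.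
  - by exists 0; rewrite // scale0r mul0r.
  - move=> _ _ [a a0 ->] [b b0 ->]; exists (a + b); first exact: addr_ge0.
    by rewrite scalerDl mulrDl.
  - move=> a _ a0 [b b0 ->]; exists (a * b); first by rewrite mulr_ge0// ltW.
    by rewrite /= scalerA mulrA.
  - by move=> _ [a a0 ->] /=; rewrite hq.2.
  move=> q' [hq' q'q q'T]; apply: le_trans (qmin _ hq' q'q _) _.
  have /q'T /= : T (y, q y) by exists 1; rewrite ?scale1r ?mul1r.
  by [].
have qD x y : q (x + y) = q x + q y.
  apply/eqP; rewrite eq_le hq.1/=.
  have := hq.1 (x + y) (- y); rewrite addrK qN; lra.
have qZ a x : q (a *: x) = a * q x.
  have [a0|a0] := leP 0 a; first exact: hq.2.
  rewrite -[a *: x]opprK qN -scaleNr hq.2 ?mulNr ?opprK// oppr_ge0; exact: ltW.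
have ql : linear (q : V -> R^o) by move=> a x y; rewrite qD qZ.
pose f : {linear V -> R^o} := HB.pack (q : V -> R^o)
  (GRing.isLinear.Build _ _ _ _ (q : V -> R^o) ql).
by exists f.
Qed.

Theorem mazur_orlicz_cone p T :
  sublinear p -> T (0, 0) ->
  (forall s t, T s -> T t -> T (s + t)) ->
  (forall (a : R) t, 0 < a -> T t -> T (a *: t.1, a * t.2)) ->
  (forall t, T t -> t.2 <= p t.1) ->
  exists f : {linear V -> R^o},
    (forall x, f x <= p x) /\ forall t, T t -> t.2 <= f t.1.
Proof.
move=> hp T0 TD TZ Tp.
have [q [hq qp qT]] := sublinear_cone_inf hp T0 TD TZ Tp.
have [f fq] := sublinear_minorant_linear hq.
exists f; split=> [x|t /qT h]; first exact: le_trans (fq x) (qp x).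
by rewrite -lerN2 -raddfN/=; exact: le_trans (fq _) h.
Qed.

End HahnBanach.

Section NormedHahnBanach.
Context {R : realType} {Z : normedModType R}.
Implicit Types (p : Z -> R) (T : set (Z * R)).

Lemma ltr_natP (x : R) : exists n : nat, x < n.+1%:R.
Proof.
exists (Num.bound `|x|); apply: le_lt_trans (ler_norm x) _.
by apply: lt_le_trans (archi_boundP (normr_ge0 x)) _; rewrite ler_nat.
Qed.

Lemma dominated_linear_continuous (f : {linear Z -> R^o}) (M : R) :
  (forall x, `|f x| <= M * `|x|) -> continuous f.
Proof.
move=> fM; apply/linear_bounded_continuous/linear_boundedP.
exists M; split; first exact: num_real.
move=> r Mr x; apply: le_trans (fM x) _.
by rewrite ler_wpM2r// ltW.
Qed.

Lemma sublinear_dominated_continuous p (f : {linear Z -> R^o}) (M : R) :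
  (forall x, p x <= M * `|x|) -> (forall x, f x <= p x) -> continuous f.
Proof.
move=> pM fp; apply: (dominated_linear_continuous (M := M)) => x.
have h y : f y <= M * `|y| by apply: le_trans (fp y) _.
rewrite ler_norml h andbT lerNl -raddfN/=.
by apply: le_trans (h _) _; rewrite normrN.
Qed.

(* [T] is only an additive semigroup: the set [T'] below is the closure of the
   rational cone that it generates, hence a convex cone. *)
Theorem mazur_orlicz p (L : R) T :
  sublinear p -> (forall x, p x <= L * `|x|) -> T (0, 0) ->
  (forall s t, T s -> T t -> T (s + t)) ->
  (forall t, T t -> t.2 <= p t.1) ->
  exists f : dual Z,
    (forall x, f x <= p x) /\ forall t, T t -> t.2 <= f t.1.
Proof.
move=> hp pL T0 TD Tp.
wlog L0 : L pL / 0 < L.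
  move=> /(_ (`|L| + 1)); apply; last by rewrite ltr_wpDl.
  move=> x; apply: le_trans (pL x) _; rewrite ler_wpM2r//.
  by rewrite (le_trans (ler_norm _))// lerDl.
have TN n s : T s -> T (n%:R *: s.1, n%:R * s.2).
  move=> Ts; elim: n => [|n IHn]; first by rewrite scale0r mul0r.
  by rewrite -natr1 scalerDl mulrDl scale1r mul1r; exact: (TD _ _ IHn Ts).
pose T' := [set t : Z * R | forall e : R, 0 < e -> exists n s,
  [/\ T s, `|s.1 - n.+1%:R *: t.1| <= n.+1%:R * e &
      n.+1%:R * (t.2 - e) <= s.2]].
have [|||| f [fp fT]] := @mazur_orlicz_cone R Z p T' hp.
- move=> e e0; exists 0, (0, 0); split => //=.
    by rewrite scaler0 subr0 normr0 mul1r ltW.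
  by rewrite sub0r mul1r oppr_le0 ltW.
- move=> s t sT tT e e0.
  have e20 : 0 < e / 2 by rewrite divr_gt0.
  have [n [s' [Ts' s1 s2]]] := sT _ e20.
  have [m [t' [Tt' t1 t2]]] := tT _ e20.
  (* The common denominator is [n.+1 * m.+1]; the predecessor undoes the successor built into
     [T']. *)
  exists (n.+1 * m.+1).-1, (m.+1%:R *: s'.1 + n.+1%:R *: t'.1, m.+1%:R * s'.2 + n.+1%:R * t'.2).
  rewrite prednK ?muln_gt0// natrM; split; first exact: (TD _ _ (TN _ _ Ts') (TN _ _ Tt')).
    have -> : m.+1%:R *: s'.1 + n.+1%:R *: t'.1 - (n.+1%:R * m.+1%:R) *: (s + t).1 =
        m.+1%:R *: (s'.1 - n.+1%:R *: s.1) + n.+1%:R *: (t'.1 - m.+1%:R *: t.1) :> Z.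
      rewrite /= !scalerBr !scalerA scalerDr [m.+1%:R * _]mulrC.
      by rewrite opprD addrACA.
    rewrite (le_trans (ler_normD _ _))// !normrZ !ger0_norm//.
    have := ler_wpM2l (ler0n R m.+1) s1; have := ler_wpM2l (ler0n R n.+1) t1; nra.
  have := ler_wpM2l (ler0n R m.+1) s2; have := ler_wpM2l (ler0n R n.+1) t2 => /=.
  nra.
- move=> a t a0 tT e e0.
  pose e' := e / (2 * a).
  have e'0 : 0 < e' by rewrite divr_gt0// mulr_gt0.
  have [n [s [Ts s1 s2]]] := tT _ e'0.
  (* The real factor [a] is replaced by [k / m.+1], with [k] the integer part of [m.+1 * a]. This
     [m] makes the rounding error, at most one unit of [t], smaller than [m.+1 * (e / 2)]. *)
  have [m hm] := ltr_natP ((`|t.1| + `|t.2 - e'|) * (2 / e)).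
  have ma0 : 0 <= m.+1%:R * a by rewrite mulr_ge0// ltW.
  pose k := Num.trunc (m.+1%:R * a).
  have /andP[k1 k2] := truncn_itv ma0; rewrite -/k -[k.+1%:R]natr1 in k1 k2.
  have m0 : 0 < m.+1%:R :> R by [].
  have n0 : 0 < n.+1%:R :> R by [].
  have kx (x : R) : 0 <= x -> x <= `|t.1| + `|t.2 - e'| -> n.+1%:R * ((m.+1%:R * a - k%:R) * x) <= n.+1%:R * (m.+1%:R * (e / 2)).
    move=> x0 xt; rewrite ler_pM2l//.
    apply: (@le_trans _ _ x); first by rewrite ler_piMl//; lra.
    have : x * (2 / e) < m.+1%:R.
      by apply: le_lt_trans hm; rewrite ler_wpM2r// divr_ge0// ltW.
    rewrite -ltr_pdivlMr ?divr_gt0// invf_div => /ltW; apply.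
  exists (n.+1 * m.+1).-1, (k%:R *: s.1, k%:R * s.2).
  rewrite prednK ?muln_gt0// natrM /=; split; first exact: TN.
    have -> : k%:R *: s.1 - (n.+1%:R * m.+1%:R) *: (a *: t.1) =
        k%:R *: (s.1 - n.+1%:R *: t.1) - (n.+1%:R * (m.+1%:R * a - k%:R)) *: t.1 :> Z.
      rewrite scalerBr !scalerA -addrA -opprD -scalerDl; congr (_ - _ *: _); ring.
    rewrite (le_trans (ler_normB _ _))// !normrZ !ger0_norm//; last first.
      lra.
    have := kx `|t.1| (normr_ge0 _); rewrite lerDl => /(_ (normr_ge0 _)).
    have := ler_wpM2l (ler0n R k) s1.
    have : k%:R * (n.+1%:R * e') <= n.+1%:R * (m.+1%:R * (e / 2)).
      have -> : n.+1%:R * (m.+1%:R * (e / 2)) = m.+1%:R * a * (n.+1%:R * e').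
        by rewrite /e'; field; rewrite gt_eqF.
      by rewrite ler_pM2r// mulr_gt0.
    rewrite -!mulrA; lra.
  have := ler_wpM2l (ler0n R k) s2.
  have := kx `|t.2 - e'| (normr_ge0 _); rewrite lerDr => /(_ (normr_ge0 _)).
  have : n.+1%:R * ((m.+1%:R * a - k%:R) * (t.2 - e')) <=
      n.+1%:R * ((m.+1%:R * a - k%:R) * `|t.2 - e'|).
    by rewrite ler_pM2l// ler_wpM2l ?ler_norm//; lra.
  have -> : e' = e / (2 * a) by [].
  set X := n.+1%:R * ((m.+1%:R * a - k%:R) * (t.2 - e / (2 * a))).
  have -> : X = n.+1%:R * m.+1%:R * (a * t.2 - e / 2) - k%:R * (n.+1%:R * (t.2 - e / (2 * a))).
    by rewrite /X; field; rewrite gt_eqF.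
  lra.
- move=> t tT; apply/ler_addgt0Pr => e e0.
  have L1 : 0 < L + 1 by rewrite addr_gt0.
  have [d d0 ->] : exists2 d : R, 0 < d & e = L * d + d.
    by exists (e / (L + 1)); [rewrite divr_gt0|field; rewrite gt_eqF].
  have [n [s [Ts s1 s2]]] := tT _ d0.
  have n0 : 0 < n.+1%:R :> R by [].
  rewrite -(ler_pM2l n0).
  have h : p s.1 <= n.+1%:R * p t.1 + L * (n.+1%:R * d).
    rewrite -(hp.2 _ _ (ltW n0)) -[s.1](subrK (n.+1%:R *: t.1)) addrC.
    apply: le_trans (hp.1 _ _) _; rewrite lerD2l.
    by apply: le_trans (pL _) _; rewrite ler_pM2l.
  have := le_trans s2 (le_trans (Tp _ Ts) h); lra.
exists (Dual (sublinear_dominated_continuous pL fp)); split => //= t Tt.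
apply: fT => e e0; exists 0, t; split => //.
  by rewrite scale1r subrr normr0 mul1r ltW.
by rewrite mul1r lerBlDr lerDl ltW.
Qed.

End NormedHahnBanach.

Section HahnBanachConsequences.
Context {R : realType} {Z : normedModType R}.

Lemma sublinear_norm : sublinear (fun x : Z => `|x|).
Proof. by split=> [x y|t x t0]; [exact: ler_normD|rewrite normrZ ger0_norm]. Qed.

Lemma norming_functional (x : Z) :
  exists f : dual Z, (forall y, f y <= `|y|) /\ f x = `|x|.
Proof.
pose T := [set t : Z * R | exists2 n : nat, True & t = (n%:R *: x, n%:R * `|x|)].
have [|||| f [fp fT]] := mazur_orlicz (L := 1) (T := T) sublinear_norm.
- by move=> y; rewrite mul1r.
- by exists 0%N => //; rewrite scale0r mul0r.
- by move=> _ _ [m _ ->] [n _ ->]; exists (m + n)%N => //; rewrite natrD scalerDl mulrDl.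
- by move=> _ [n _ ->] /=; rewrite normrZ ger0_norm.
exists f; split=> //; apply/eqP; rewrite eq_le fp/=.
by apply: (fT (x, `|x|)); exists 1%N => //; rewrite scale1r mul1r.
Qed.

(** Hahn-Banach extension from an additive subgroup: the graph of [g] is a semigroup, which is what
    [mazur_orlicz] accepts. This form applies both to closed subspaces and to countable
    subgroups. *)
Lemma dual_extend (C : set Z) (g : Z -> R) (M : R) : 0 <= M ->
  C 0 -> (forall x y, C x -> C y -> C (x - y)) ->
  (forall x y, C x -> C y -> g (x - y) = g x - g y) ->
  (forall x, C x -> g x <= M * `|x|) ->
  exists f : dual Z, (forall x, C x -> f x = g x) /\ forall y, f y <= M * `|y|.
Proof.
move=> M0 C0 CB gB gM; pose T := [set t : Z * R | C t.1 /\ t.2 = g t.1].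
have g0 : g 0 = 0 by have := gB _ _ C0 C0; rewrite !subr0 subrr.
have CN x : C x -> C (- x) by rewrite -sub0r; exact: CB.
have gN x : C x -> g (- x) = - g x by move=> Cx; rewrite -sub0r gB// g0 sub0r.
have hM : sublinear (fun x : Z => M * `|x|).
  split=> [x y|t x t0]; first by rewrite -mulrDr ler_wpM2l// ler_normD.
  by rewrite normrZ ger0_norm// mulrCA.
have [|||| f [fp fT]] := mazur_orlicz (L := M) (T := T) hM.
- by [].
- by [].
- move=> [s a] [t b] [/= Cs ->] [/= Ct ->].
  have Ct' := CN _ Ct; split=> /=; first by rewrite -[t]opprK; exact: CB.
  by rewrite -{2}[t]opprK gB// gN// opprK.
- by move=> [s a] [/= Cs ->]; exact: gM.
exists f; split=> // x Cx; apply/eqP; rewrite eq_le.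
apply/andP; split; last exact: (fT (x, g x)).
by have := fT (- x, g (- x)) (conj (CN _ Cx) erefl); rewrite /= raddfN gN// lerN2.
Qed.

End HahnBanachConsequences.

(** * A smooth variational principle *)

Section VariationalPrinciple.
Context {R : realType} {Z : normedModType R}.

Definition converges (u : nat -> Z) (l : Z) :=
  forall e : R, 0 < e -> exists N, forall n, (N <= n)%N -> `|u n - l| < e.

(** Completeness is a predicate on a normed module, so that it can be transported to products by
    [seq_complete_prod]. *)
Definition seq_complete := forall u : nat -> Z,
  (forall e : R, 0 < e -> exists N, forall m n, (N <= m)%N -> (N <= n)%N ->
     `|u m - u n| < e) -> exists l, converges u l.

Definition adherent (C : set Z) : set Z :=
  [set x | forall e : R, 0 < e -> exists2 c, C c & `|x - c| < e].

Lemma converges_adherent (S : set Z) u l :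
  converges u l -> (forall n, S (u n)) -> adherent S l.
Proof.
move=> ul Su e e0; have [N uN] := ul e e0.
by exists (u N) => //; rewrite distrC; exact: uN.
Qed.

Lemma dyadic_small (a e : R) : 0 < e -> exists N, forall n, (N <= n)%N -> a / 2 ^+ n < e.
Proof.
move=> e0; have [N hN] := ltr_natP (a / e); exists N.+1 => n Nn.
rewrite ltr_pdivrMr ?exprn_gt0// mulrC -ltr_pdivrMr//; apply: lt_le_trans hN _.
apply: le_trans (_ : n%:R <= _); first by rewrite ler_nat.
by rewrite -natrX ler_nat ltnW// ltn_expl.
Qed.

Variables (S : set Z) (theta : Z -> R) (rho : Z -> Z -> R).
Hypothesis cZ : seq_complete.
Hypothesis Scl : forall x, adherent S x -> S x.
Hypothesis theta0 : forall x, S x -> 0 <= theta x.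
Hypothesis thetac : forall x, S x -> forall e : R, 0 < e ->
  exists2 d : R, 0 < d & forall y, S y -> `|y - x| < d -> `|theta y - theta x| < e.
Hypothesis rho0 : forall x, rho x x = 0.
Hypothesis rho_ge : forall x y, S x -> S y -> `|x - y| ^+ 2 <= 8 * rho x y.
Hypothesis rho_le : forall x y z, S x -> S y -> S z ->
  rho x z - rho y z <= `|x - y| * (`|x - z| + `|y - z|).

(* Borwein and Preiss: [w] minimizes [theta] plus the infinite sum of the
   [mu j * rho _ (x j)]. The statement keeps finitely many terms and replaces the
   others by their Lipschitz estimate; [N = 0] is Ekeland's principle. *)
Lemma smooth_variational_principle (x0 : Z) (e0 l : R) :
  S x0 -> 0 < e0 -> 0 < l -> theta x0 <= e0 ->
  let mu j := 8 * e0 / l ^+ 2 / 2 ^+ j in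
  exists (x : nat -> Z) (w : Z), [/\ S w, forall n, S (x n),
    forall n, `|w - x n| <= l, x 0%N = x0 &
    forall N s, S s -> `|s - w| <= l ->
      theta w + \sum_(j < N) mu j * rho w (x j) <=
      theta s + \sum_(j < N) mu j * rho s (x j) + 6 * l * mu N * `|s - w|].
Proof.
move=> Sx0 e00 l0 thx0 mu.
have mu0 j : 0 < mu j by rewrite /mu !divr_gt0// ?exprn_gt0// mulr_gt0.
have rho_ge0 x y : S x -> S y -> 0 <= rho x y.
  by move=> Sx Sy; have := rho_ge Sx Sy; have := sqr_ge0 `|x - y|; lra.
(* The tolerance of the [n]-th approximate minimization. If [mu n * rho s (x n) <= ep n], then
   [rho_ge] gives [|s - x n| <= l / 2 ^+ n]; moreover [ep 0] is [e0]. *)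
pose ep n := mu n * ((l / 2 ^+ n) ^+ 2 / 8).
have ep0 n : 0 < ep n.
  by rewrite /ep mulr_gt0// divr_gt0// exprn_gt0// divr_gt0// exprn_gt0.
(* An almost minimizer that does not exceed the value at [x]: take one from the infimum, or keep [x]
   if that one is worse. *)
have pickP (th : Z -> R) x (e : R) : (forall s, S s -> 0 <= th s) -> S x -> 0 < e ->
    exists x', [/\ S x', th x' <= th x & forall s, S s -> th x' <= th s + e].
  move=> th_ge Sx e_gt.
  have hA : has_inf [set th s | s in S].
    split; first by exists (th x), x.
    by exists 0 => _ [s Ss <-]; exact: th_ge.
  have lbA s : S s -> inf [set th s | s in S] <= th s.
    by move=> Ss; apply: (ge_inf hA.2); exists s.
  have [_ [s Ss <-] hs] := inf_adherent e_gt hA.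
  have [h|h] := leP (th s) (th x).
    exists s; split=> // s' Ss'; apply: ltW; apply: lt_le_trans hs _.
    by rewrite lerD2r; exact: lbA.
  exists x; split=> // s' Ss'; apply: ltW; apply: lt_trans h _.
  by apply: lt_le_trans hs _; rewrite lerD2r; exact: lbA.
pose pick (th : Z -> R) x (e : R) := xget x [set x' | [/\ S x', th x' <= th x &
  forall s, S s -> th x' <= th s + e]].
pose step n (st : (Z -> R) * Z) :=
  let th' := fun s => st.1 s + mu n * rho s st.2 in (th', pick th' st.2 (ep n.+1)).
pose st := fix F n := if n is m.+1 then step m (F m) else (theta, x0).
pose th n := (st n).1; pose x n := (st n).2.
have thS n s : th n.+1 s = th n s + mu n * rho s (x n) by [].
have xS n : x n.+1 = pick (th n.+1) (x n) (ep n.+1) by [].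
have thx : forall n, S (x n) /\ (forall s, S s -> 0 <= th n s).
  elim=> [|n [Sx th_ge]]; first by split.
  have th_ge' s : S s -> 0 <= th n.+1 s.
    by move=> Ss; rewrite thS addr_ge0 ?th_ge// mulr_ge0 ?rho_ge0// ltW.
  split=> //; rewrite xS /pick.
  have [x' hx'] := pickP (th n.+1) (x n) (ep n.+1) th_ge' Sx (ep0 _).
  by case: xgetP => [y _ []//|/(_ x') []].
have Sx n := (thx n).1; have th_ge n := (thx n).2.
have xP n : th n.+1 (x n.+1) <= th n.+1 (x n) /\
    forall s, S s -> th n.+1 (x n.+1) <= th n.+1 s + ep n.+1.
  rewrite xS /pick.
  have [x' hx'] := pickP (th n.+1) (x n) (ep n.+1) (th_ge n.+1) (Sx n) (ep0 _).
  by case: xgetP => [y _ []//|/(_ x') []].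
have xmin n s : S s -> th n (x n) <= th n s + ep n.
  case: n => [|n] Ss; last exact: (xP n).2.
  have -> : th 0%N (x 0%N) = theta x0 by [].
  have -> : ep 0%N = e0.
    rewrite /ep /mu !expr0 !divr1; field; rewrite gt_eqF//.
  by apply: le_trans thx0 _; rewrite lerDr; exact: (th_ge 0%N).
have thmono n m s : S s -> (n <= m)%N -> th n s <= th m s.
  move=> Ss /subnK <-; elim: (m - n)%N => [//|k IH].
  apply: le_trans IH _; rewrite addSn thS lerDl mulr_ge0 ?rho_ge0//; exact: ltW.
have thxx n : th n.+1 (x n) = th n (x n) by rewrite thS rho0 mulr0 addr0.
have amono n m : (n <= m)%N -> th m (x m) <= th n (x n).
  move=> /subnK <-; elim: (m - n)%N => [//|k IH].
  by apply: le_trans IH; rewrite addSn; apply: le_trans (xP _).1 _; rewrite thxx.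
(* All later iterates stay in the sublevel set [th n.+1 <= th n (x n)], which by [near] has radius
   [l / 2 ^+ n] about [x n]. So [x] is Cauchy, and lower semicontinuity ([thc]) puts its limit in
   all these sets. *)
have nest n m : (n <= m)%N -> th n.+1 (x m) <= th n (x n).
  rewrite leq_eqVlt => /orP[/eqP <-|nm]; first by rewrite thxx.
  by apply: le_trans (thmono _ _ _ (Sx m) nm) _; apply: amono; exact: ltnW.
have near n s : S s -> th n.+1 s <= th n (x n) -> `|s - x n| <= l / 2 ^+ n.
  move=> Ss hs; have := xmin n s Ss; rewrite thS in hs => hm.
  have : mu n * rho s (x n) <= ep n by lra.
  rewrite ler_pM2l// => hr; have := rho_ge Ss (Sx n).
  have l2 : 0 <= l / 2 ^+ n by rewrite divr_ge0 ?exprn_ge0// ltW.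
  by move=> h; rewrite -ler_sqr ?nnegrE//; lra.
have [w xw] : exists w, converges x w.
  apply: cZ => e e_gt; have [N hN] := dyadic_small (2 * l) e_gt; exists N => m n Nm Nn.
  apply: le_lt_trans (hN N (leqnn N)).
  have -> : x m - x n = (x m - x N) + - (x n - x N) by rewrite opprB addrA subrK.
  apply: le_trans (ler_normD _ _) _; rewrite normrN -mulrA mulr_natl mulr2n.
  by apply: lerD; apply: near => //; exact: nest.
have Sw : S w by apply: Scl; apply: converges_adherent xw Sx.
have thc : forall n (e : R), 0 < e -> exists2 d : R, 0 < d &
    forall y, S y -> `|y - w| < d -> th n w <= th n y + e.
  elim=> [|n IH] e e_gt.
    have [d d0 hd] := thetac Sw e_gt; exists d => // y Sy /(hd y Sy).
    by rewrite distrC ltr_norml => /andP[_]; rewrite ltrBlDl => /ltW.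
  have e2 : 0 < e / 2 by rewrite divr_gt0.
  have [d d0 hd] := IH _ e2.
  pose K := mu n * (2 * `|w - x n| + 1).
  have K0 : 0 < K by rewrite mulr_gt0// ltr_wpDl// mulr_ge0.
  exists (Num.min d (Num.min 1 (e / 2 / K))).
    by rewrite !lt_min d0 ltr01 divr_gt0.
  move=> y Sy; rewrite !lt_min => /and3P[yd y1 yK]; rewrite !thS.
  have h1 := hd y Sy yd; have h2 := rho_le Sw Sy (Sx n).
  have h3 : `|y - x n| <= `|w - x n| + 1.
    by have := ler_distD w y (x n); lra.
  rewrite distrC in h2.
  have h4 : mu n * (rho w (x n) - rho y (x n)) <= K * `|y - w|.
    rewrite /K -mulrA ler_pM2l//; apply: le_trans h2 _; rewrite mulrC ler_wpM2r//; lra.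
  have h5 : K * `|y - w| <= e / 2.
    by move: yK; rewrite ltr_pdivlMr// mulrC => /ltW.
  lra.
have thw n : th n.+1 w <= th n (x n).
  apply/ler_addgt0Pr => e e_gt; have [d d0 hd] := thc n.+1 e e_gt.
  have [M hM] := xw _ d0.
  have := hd _ (Sx (maxn M n)) (hM _ (leq_maxl _ _)).
  by have := nest n _ (leq_maxr M n); lra.
have wx n : `|w - x n| <= l / 2 ^+ n by apply: near.
have wxl n : `|w - x n| <= l.
  apply: le_trans (wx n) _; rewrite ler_pdivrMr ?exprn_gt0//.
  by rewrite ler_peMr ?(ltW l0)// exprn_ege1// ler1n.
exists x, w; split => // N s Ss swl.
have thE n z : th n z = theta z + \sum_(j < n) mu j * rho z (x j).
  elim: n => [|n IH]; first by rewrite big_ord0 addr0.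
  by rewrite thS IH big_ord_recr/= addrA.
rewrite -!thE.
have muS n : mu n.+1 = mu n / 2.
  by rewrite /mu; set A := 8 * e0 / l ^+ 2; rewrite exprSr invfM mulrA.
(* The factor 3 arises since [s] is within [2 * l] and [w] within [l] of [x n]. The tail of [mu]
   from [N] on sums to [2 * mu N], whence the 6 of the statement. *)
have diff n : mu n * (rho s (x n) - rho w (x n)) <= mu n * (3 * l * `|s - w|).
  rewrite ler_pM2l//; apply: le_trans (rho_le Ss Sw (Sx n)) _.
  rewrite mulrC ler_wpM2r//; have := wxl n; have := ler_distD w s (x n); lra.
have tel n : (N <= n)%N -> th N w - th N s <= th n w - th n s +
    3 * l * `|s - w| * (2 * mu N - 2 * mu n).
  move=> /subnK <-; elim: (n - N)%N => [|k IH]; first by rewrite subrr mulr0 addr0.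
  apply: le_trans IH _; rewrite addSn !thS muS; have := diff (k + N)%N.
  set a := 3 * l * `|s - w|; nra.
apply/ler_addgt0Pr => e e_gt.
have [M hM] := dyadic_small (8 * e0 / l ^+ 2 * (l ^+ 2 / 8)) e_gt.
pose n := maxn M N.
have epn : ep n <= e.
  apply: le_trans (ltW (hM n (leq_maxl _ _))).
  rewrite mulrAC ler_pM2l// ler_pM2r ?invr_gt0//.
  rewrite ler_sqr ?nnegrE ?divr_ge0 ?exprn_ge0 ?(ltW l0)//.
  rewrite ler_pdivrMr ?exprn_gt0//.
  by rewrite ler_peMr ?(ltW l0)// exprn_ege1// ler1n.
have := tel n (leq_maxr _ _); have := thw n; have := xmin n s Ss; have := mu0 n.
have : th n w <= th n.+1 w by apply: thmono.
have : 0 <= l * `|s - w| by rewrite mulr_ge0// ltW.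
set a := l * `|s - w|.
have -> : 6 * l * mu N * `|s - w| = 6 * (a * mu N) by rewrite /a; ring.
have -> : 3 * l * `|s - w| * (2 * mu N - 2 * mu n) = 6 * (a * mu N) - 6 * (a * mu n).
  by rewrite /a; ring.
move=> a0 h1 mn h2 h3; have : 0 <= a * mu n by rewrite mulr_ge0// ltW.
lra.
Qed.

End VariationalPrinciple.

(** * A Frechet smooth gauge on a subspace with separable dual *)

Section DualCombination.
Context {R : realType} {Z : normedModType R}.
Variables (a b : R) (f g : dual Z).

Definition dual_comb_fun (x : Z) : R^o := a * f x + b * g x.

Lemma dual_comb_linear : linear dual_comb_fun.
Proof.
move=> k x y; rewrite /dual_comb_fun !linearP /= /GRing.scale /=; ring.
Qed.

HB.instance Definition _ :=
  GRing.isLinear.Build R Z R^o *:%R dual_comb_fun dual_comb_linear.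

Lemma dual_comb_continuous : continuous dual_comb_fun.
Proof.
by move=> x; apply: cvgD; apply: cvgMr; exact: dual_continuous.
Qed.

Definition dual_comb : dual Z := Dual dual_comb_continuous.

Lemma dual_combE x : dual_comb x = a * f x + b * g x. Proof. by []. Qed.

End DualCombination.

Lemma dualZ {R : realType} {Z : normedModType R} (f : dual Z) (a : R) x :
  f (a *: x) = a * f x.
Proof. exact: linearZ. Qed.

(** Total boundedness of a bounded set of [m.+1] coordinates: [phi] rounds them to a grid of mesh
    [e], and a point of [B] is chosen in each occupied cell ([x0] for the empty ones). *)
Lemma finite_net {R : realType} {T : Type} (B : set T) (x0 : T) (m : nat)
    (g : nat -> T -> R) (M e : R) :
  B x0 -> 0 < e -> (forall i x, (i <= m)%N -> B x -> `|g i x| <= M) ->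
  exists (I : finType) (r : I -> T), (forall i, B (r i)) /\
    forall x, B x -> exists i, forall j, (j <= m)%N -> `|g j x - g j (r i)| <= e.
Proof.
move=> Bx0 e0 gM.
have [N hN] := ltr_natP (2 * M / e).
pose phi x := [ffun j : 'I_m.+1 => inord (Num.trunc ((g j x + M) / e)) : 'I_N.+1].
pose I := {ffun 'I_m.+1 -> 'I_N.+1}.
exists I, (fun v => if pselect (exists x, B x /\ phi x = v) is left h then sval (cid h) else x0).
split=> [i|x Bx]; first by case: pselect => // h; case: (svalP (cid h)).
exists (phi x) => j jm; case: pselect => [h|[]]; last by exists x.
have [] := svalP (cid h); set y := sval _ => By xy.
have bd z : B z -> 0 <= (g j z + M) / e < N.+1%:R.
  move=> Bz; have := gM j z jm Bz; rewrite ler_norml => /andP[h1 h2].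
  apply/andP; split; first by rewrite divr_ge0 ?(ltW e0)//; lra.
  by apply: le_lt_trans hN; rewrite ler_pM2r ?invr_gt0//; lra.
have phiE z : B z -> phi z (inord j) = Num.trunc ((g j z + M) / e) :> nat.
  move=> Bz; rewrite ffunE !inordK ?ltnS//.
  by have /andP[h1 h2] := bd _ Bz; rewrite -ltnS truncn_lt_nat.
have := phiE x Bx; rewrite -xy phiE// => eqt.
have /andP[/truncn_itv/andP[x1 x2] _] := bd _ Bx.
have /andP[/truncn_itv/andP[y1 y2] _] := bd _ By.
rewrite eqt in y1 y2; rewrite -natr1 in x2 y2.
have : `|(g j x + M) / e - (g j y + M) / e| <= 1.
  by rewrite ler_norml; apply/andP; split; lra.
rewrite -mulrBl normrM (ger0_norm (ltW _ : 0 <= e^-1)) ?invr_gt0//.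
rewrite ler_pdivrMr// mul1r; congr (`|_| <= _); ring.
Qed.

Lemma complete_seq_complete (R : realType) (Z : completeNormedModType R) :
  @seq_complete R Z.
Proof.
move=> u uC; have : cvgn u.
  apply/cauchy_cvgP/cauchy_exP => _ /posnumP[e].
  have [N hN] := uC _ (gt0 e); exists (u N), N => // n /= Nn.
  by rewrite -ball_normE/=; apply: hN.
move=> /cvgrPdist_lt uL; exists (limn u) => e /uL[N _ hN].
by exists N => n Nn; rewrite distrC; apply: hN.
Qed.

Section SmoothGauge.
Context {R : realType} {Z : normedModType R}.
Variables (C : set Z) (K : nat -> set Z).
Hypothesis C0 : C 0.
Hypothesis CB : forall x y, C x -> C y -> C (x - y).
Hypothesis CH : forall x, C x -> C (2^-1 *: x).
Let B := [set x | C x /\ `|x| <= 1].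
Hypothesis K0 : K 0%N = B.
Hypothesis KB : forall n x, K n x -> B x.
Hypothesis Kz : forall n, K n 0.
Hypothesis K1 : forall x, B x -> exists n, K n x /\ forall y, K n y -> y = 0 \/ y = x.
Hypothesis K2 : forall (f : dual Z) (e : R), 0 < e -> exists n,
  (forall x, K n x -> `|f x| <= e) /\
  exists (I : finType) (r : I -> Z), (forall i, B (r i)) /\
    forall x, B x -> exists i, K n (2^-1 *: (x - r i)).
Let E := adherent C.
Implicit Types (f g h : dual Z).

Lemma subgroupD x y : C x -> C y -> C (x + y).
Proof. by move=> Cx Cy; rewrite -[y]opprK -[- y]sub0r; apply/CB/CB. Qed.

Lemma subgroupMn n x : C x -> C (n%:R *: x).
Proof.
move=> Cx; elim: n => [|n IH]; first by rewrite scale0r.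
by rewrite -natr1 scalerDl scale1r; exact: subgroupD.
Qed.

Lemma subgroup_dyadic n x : C x -> C ((2 ^+ n)^-1 *: x).
Proof.
move=> Cx; elim: n => [|n IH]; first by rewrite expr0 invr1 scale1r.
by rewrite exprS invfM -scalerA; exact: CH.
Qed.

Lemma subset_adherent x : C x -> E x.
Proof. by move=> Cx e e0; exists x; rewrite // subrr normr0. Qed.

Lemma adherentB x y : E x -> E y -> E (x - y).
Proof.
move=> Ex Ey e e0; have e2 : 0 < e / 2 by rewrite divr_gt0.
have [c Cc xc] := Ex _ e2; have [d Cd yd] := Ey _ e2.
exists (c - d); first exact: CB.
have -> : x - y - (c - d) = (x - c) - (y - d) by rewrite !opprB addrACA [RHS]addrACA [- y + _]addrC.
by apply: le_lt_trans (ler_normB _ _) _; lra.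
Qed.

Lemma adherentD x y : E x -> E y -> E (x + y).
Proof.
move=> Ex Ey; rewrite -[y]opprK -[- y]sub0r; apply: adherentB => //.
by apply: adherentB => //; exact: subset_adherent.
Qed.

(* Since [K 0] is the unit ball of [C], [seminorm_on 0] is the norm of the dual of
   [E]. The other [K n] are of two kinds: those given by [K1] make [seminorm_on n]
   the evaluation at a point, those given by [K2] make it small at a given
   functional while still controlling the norm up to finitely many evaluations. *)
Definition seminorm_on n f : R := sup [set `|f x| | x in K n].
Local Notation p := seminorm_on.

Lemma dual_bounded f : exists2 M, 0 < M & forall x, `|f x| <= M * `|x|.
Proof.
have /linear_bounded_continuous/linear_boundedP := @dual_continuous _ _ f.
case=> M [_ h]; exists (`|M| + 1); first by rewrite ltr_wpDl.
by apply: h; rewrite (le_lt_trans (ler_norm M))// ltrDl.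
Qed.

Lemma seminorm_has_sup n f : has_sup [set `|f x| | x in K n].
Proof.
split; first by exists `|f 0|, 0.
have [M M0 fM] := dual_bounded f.
exists M => _ [x /KB[_ x1] <-]; apply: le_trans (fM x) _.
by rewrite ler_piMr// ltW.
Qed.

Lemma seminorm_ub n f x : K n x -> `|f x| <= p n f.
Proof. by move=> Kx; apply: (ub_le_sup (seminorm_has_sup n f).2); exists x. Qed.

Lemma seminorm_le n f M : (forall x, K n x -> `|f x| <= M) -> p n f <= M.
Proof.
by move=> h; apply: ge_sup (seminorm_has_sup n f).1 _ => _ [x Kx <-]; exact: h.
Qed.

Lemma seminorm_ge0 n f : 0 <= p n f.
Proof. by apply: le_trans (seminorm_ub f (Kz n)). Qed.

Lemma seminorm_le0 n f : p n f <= p 0 f.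
Proof.
by apply: seminorm_le => x /KB Bx; apply: seminorm_ub; rewrite K0.
Qed.

(** A point of [C] cannot be divided by its norm inside [C]; a dyadic multiple of norm almost 1
    replaces the quotient. Density then gives [E]. *)
Lemma seminorm_bound f x : E x -> `|f x| <= p 0 f * `|x|.
Proof.
have hC y : C y -> `|f y| <= p 0 f * `|y|.
  move=> Cy; have [->|y0] := eqVneq y 0; first by rewrite raddf0 !normr0 mulr0.
  have t0 : 0 < `|y| by rewrite normr_gt0.
  rewrite -ler_pdivrMr//; apply/ler_addgt0Pr => e e0.
  have [m hm] := dyadic_small `|f y| e0; have := hm m (leqnn m); set d := 2 ^+ m => fe.
  have d0 : 0 < d by rewrite /d exprn_gt0.
  pose n := Num.trunc (d / `|y|).
  have /truncn_itv/andP[n1 n2] : 0 <= d / `|y| by rewrite divr_ge0// ltW.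
  rewrite -/n in n1 n2.
  have Ky : K 0 (d^-1 *: (n%:R *: y)).
    rewrite K0; split; first by apply/subgroup_dyadic/subgroupMn.
    rewrite !normrZ gtr0_norm ?invr_gt0// ger0_norm// ler_pdivrMl// mulr1.
    by rewrite -ler_pdivlMr.
  have := seminorm_ub f Ky; rewrite !linearZ /= /GRing.scale /= !normrM.
  rewrite gtr0_norm ?invr_gt0// ger0_norm// => h.
  apply: le_trans (_ : d^-1 * (n.+1%:R * `|f y|) <= _).
    rewrite ler_pdivlMl// mulrCA mulrC ler_wpM2r//; first exact: ltW.
  rewrite -natr1 mulrDl mul1r mulrDr; apply: lerD => //.
  by rewrite mulrC ltW.
move=> Ex; apply/ler_addgt0Pr => e e0.
have [M M0 fM] := dual_bounded f.
have q0 : 0 <= p 0 f by exact: seminorm_ge0.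
have d0 : 0 < e / (M + p 0 f) by rewrite divr_gt0// ltr_wpDr.
have [c Cc xc] := Ex _ d0.
have h1 : `|f x| <= `|f c| + M * `|x - c|.
  apply: le_trans (_ : `|f c| + `|f (x - c)| <= _); last by rewrite lerD2l.
  by rewrite raddfB/=; apply: le_trans (ler_normD _ _); rewrite addrC subrK.
have h2 : `|c| <= `|x| + `|x - c|.
  by have := ler_distD x c 0; rewrite !subr0 distrC addrC.
have h3 := hC c Cc.
have h4 : (M + p 0 f) * `|x - c| <= e.
  by rewrite mulrC -ler_pdivlMr ?ltW// ltr_wpDr.
nra.
Qed.

Lemma seminorm_mid n f g : p n (dual_comb 2^-1 2^-1 f g) <= (p n f + p n g) / 2.
Proof.
apply: seminorm_le => x Kx; rewrite dual_combE -mulrDr normrM gtr0_norm//.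
rewrite mulrC ler_pM2r// (le_trans (ler_normD _ _))// lerD// seminorm_ub//.
Qed.

Definition energy_sum N f : R := \sum_(n < N) (2 ^+ n)^-1 * p n f ^+ 2.

Lemma energy_sumS N f : energy_sum N.+1 f = energy_sum N f + (2 ^+ N)^-1 * p N f ^+ 2.
Proof. by rewrite /energy_sum big_ord_recr. Qed.

Lemma energy_term_ge0 n f : 0 <= (2 ^+ n)^-1 * p n f ^+ 2.
Proof. by rewrite mulr_ge0 ?sqr_ge0// invr_ge0 exprn_ge0. Qed.

Lemma energy_sum_mono N M f : (N <= M)%N -> energy_sum N f <= energy_sum M f.
Proof.
move=> /subnK <-; elim: (M - N)%N => [//|k IH].
by apply: le_trans IH _; rewrite addSn energy_sumS lerDl energy_term_ge0.
Qed.

Lemma geometric_sum (N : nat) : \sum_(n < N) (2 ^+ n)^-1 = 2 - 2 / 2 ^+ N :> R.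
Proof.
elim: N => [|N IH]; first by rewrite big_ord0 expr0 divr1 subrr.
by rewrite big_ord_recr/= IH exprS; field; rewrite expf_neq0.
Qed.

Lemma energy_sum_le N f : energy_sum N f <= 2 * p 0 f ^+ 2.
Proof.
apply: le_trans (_ : (\sum_(n < N) (2 ^+ n)^-1) * p 0 f ^+ 2 <= _).
  rewrite mulr_suml; apply: ler_sum => n _; rewrite ler_wpM2l ?invr_ge0 ?exprn_ge0//.
  by rewrite ler_sqr ?nnegrE ?seminorm_ge0// seminorm_le0.
rewrite ler_wpM2r ?sqr_ge0// geometric_sum gerBl.
by rewrite divr_ge0// exprn_ge0.
Qed.

Definition energy f : R := sup (range (fun N => energy_sum N f)).

Lemma energy_has_sup f : has_sup (range (fun N => energy_sum N f)).
Proof.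
split; first by exists (energy_sum 0 f), 0%N.
by exists (2 * p 0 f ^+ 2) => _ [N _ <-]; exact: energy_sum_le.
Qed.

Lemma energy_ub N f : energy_sum N f <= energy f.
Proof. by apply: (ub_le_sup (energy_has_sup f).2); exists N. Qed.

Lemma energy_le f M : (forall N, energy_sum N f <= M) -> energy f <= M.
Proof.
by move=> h; apply: ge_sup (energy_has_sup f).1 _ => _ [N _ <-]; exact: h.
Qed.

Lemma energy_ge f : p 0 f ^+ 2 <= energy f.
Proof.
apply: le_trans (energy_ub 1 f).
by rewrite energy_sumS /energy_sum big_ord0 add0r expr0 invr1 mul1r.
Qed.

Lemma energy_le2 f : energy f <= 2 * p 0 f ^+ 2.
Proof. by apply: energy_le => N; exact: energy_sum_le. Qed.

Lemma energy_ge0 f : 0 <= energy f.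
Proof. exact: le_trans (sqr_ge0 _) (energy_ge f). Qed.

(** Each square [p k ^+ 2] contributes a nonnegative midpoint convexity defect [d k]. Keeping the
    one of index [n] makes the convexity of [energy] control every seminorm separately. *)
Lemma energy_mid n f g (h := dual_comb 2^-1 2^-1 f g) :
  energy h + (2 ^+ n)^-1 * ((p n f ^+ 2 + p n g ^+ 2) / 2 - p n h ^+ 2) <=
  (energy f + energy g) / 2.
Proof.
 rewrite -lerBrDr; apply: energy_le => N; rewrite lerBrDr.
pose d k := (p k f ^+ 2 + p k g ^+ 2) / 2 - p k h ^+ 2.
have d0 k : 0 <= d k.
  have := seminorm_mid k f g; rewrite -/h /d => hk; have := seminorm_ge0 k h.
  have := sqr_ge0 (p k f - p k g).
  set a := p k f in hk *; set b := p k g in hk *; set c := p k h in hk * => ab c0.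
  have : c ^+ 2 <= ((a + b) / 2) ^+ 2 by rewrite ler_sqr ?nnegrE//; lra.
  nra.
have sum_mid M : energy_sum M h + \sum_(k < M) (2 ^+ k)^-1 * d k =
    (energy_sum M f + energy_sum M g) / 2.
  rewrite /energy_sum -!big_split/= mulr_suml; apply: eq_bigr => k _; rewrite /d; field.
  by rewrite expf_neq0.
pose M := maxn N n.+1.
have h1 : energy_sum N h <= energy_sum M h by apply/energy_sum_mono/leq_maxl.
have h2 : (2 ^+ n)^-1 * d n <= \sum_(k < M) (2 ^+ k)^-1 * d k.
  have nM : (n < M)%N by apply: leq_maxr.
  rewrite (bigD1 (Ordinal nM))//= lerDl sumr_ge0// => k _.
  by rewrite mulr_ge0// invr_ge0 exprn_ge0.
have := sum_mid M; have := energy_ub M f; have := energy_ub M g; rewrite -/(d n); lra.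
Qed.

(* The Legendre conjugate of [energy]. Near-maximizers of [f x - energy f]
   converge in norm, because [energy] is convex enough, so by the Smulian
   criterion the conjugate is Frechet differentiable. *)
Definition gauge x : R := sup (range (fun f => f x - energy f)).

Lemma gauge_term_le f x : E x -> f x - energy f <= `|x| ^+ 2 / 4.
Proof.
move=> Ex; have h1 := seminorm_bound f Ex; have h2 := energy_ge f.
have := ler_norm (f x); have := sqr_ge0 (p 0 f - `|x| / 2).
nra.
Qed.

Lemma gauge_has_sup x : E x -> has_sup (range (fun f => f x - energy f)).
Proof.
move=> Ex; have [f _] := norming_functional x; split; first by exists (f x - energy f), f.
by exists (`|x| ^+ 2 / 4) => _ [g _ <-]; exact: gauge_term_le.
Qed.

Lemma gauge_ub f x : E x -> f x - energy f <= gauge x.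
Proof. by move=> Ex; apply: (ub_le_sup (gauge_has_sup Ex).2); exists f. Qed.

Lemma gauge_le x : E x -> gauge x <= `|x| ^+ 2 / 4.
Proof.
by move=> Ex; apply: ge_sup (gauge_has_sup Ex).1 _ => _ [f _ <-]; exact: gauge_term_le.
Qed.

(** Since [energy] is at most twice the squared norm, test with the norming functional times
    [|x| / 4], the maximizer of [t * |x| - 2 * t ^+ 2]. The [1 / 4] of [gauge_le] is likewise the
    maximum of [t * |x| - t ^+ 2]. *)
Lemma gauge_ge x : E x -> `|x| ^+ 2 / 8 <= gauge x.
Proof.
move=> Ex; have [f [f1 fx]] := norming_functional x.
pose g := dual_comb (`|x| / 4) 0 f f.
apply: le_trans (gauge_ub g Ex).
have pg : p 0 g <= `|x| / 4.
  apply: seminorm_le => y /KB[_ y1]; rewrite dual_combE mul0r addr0 normrM.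
  rewrite ger0_norm ?divr_ge0// ler_piMr ?divr_ge0//.
  apply: le_trans y1; rewrite ler_norml f1 andbT lerNl -raddfN/=.
  by rewrite -[leRHS]normrN f1.
have := energy_le2 g; have := seminorm_ge0 0 g.
rewrite dual_combE mul0r addr0 fx => g0 eg.
have : p 0 g ^+ 2 <= (`|x| / 4) ^+ 2 by rewrite ler_sqr ?nnegrE ?divr_ge0.
nra.
Qed.

(** The midpoint of [f] and [g] cannot exceed the supremum [gauge x], so the gain recorded in
    [energy_mid] is at most [t]. *)
Lemma near_maximizers n f g x t : E x ->
  gauge x - t <= f x - energy f -> gauge x - t <= g x - energy g ->
  (p n f ^+ 2 + p n g ^+ 2) / 2 - p n (dual_comb 2^-1 2^-1 f g) ^+ 2 <= 2 ^+ n * t.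
Proof.
move=> Ex hf hg; have /= := energy_mid n f g.
have := gauge_ub (dual_comb 2^-1 2^-1 f g) Ex; rewrite dual_combE => h1 h2.
rewrite -ler_pdivrMl ?exprn_gt0//; lra.
Qed.

(** When [p n] is evaluation at [y], the defect is exactly [(f y - g y) ^+ 2 / 4]. *)
Lemma near_maximizers_eval f g x y n t : E x -> K n y ->
  (forall z, K n z -> z = 0 \/ z = y) ->
  gauge x - t <= f x - energy f -> gauge x - t <= g x - energy g ->
  (f y - g y) ^+ 2 <= 4 * (2 ^+ n * t).
Proof.
move=> Ex Ky Kny hf hg; have := near_maximizers n Ex hf hg.
have pE h : p n h = `|h y|.
  apply/eqP; rewrite eq_le seminorm_ub// andbT; apply: seminorm_le => z /Kny[->|->] //.
  by rewrite raddf0 normr0.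
rewrite !pE dual_combE !real_normK ?num_real//; nra.
Qed.

Lemma near_maximizer_bound f x : E x ->
  gauge x - 1 <= f x - energy f -> p 0 f <= `|x| + 1.
Proof.
move=> Ex hf; have := seminorm_bound f Ex; have := energy_ge f; have := gauge_ge Ex.
have := ler_norm (f x); have := sqr_ge0 `|x|; have := seminorm_ge0 0 f.
have := normr_ge0 x; nra.
Qed.

Lemma maximizer_bound f x : E x -> gauge x = f x - energy f -> p 0 f <= `|x|.
Proof.
move=> Ex hf; have := seminorm_bound f Ex; have := energy_ge f; have := gauge_ge Ex.
have := ler_norm (f x); have := sqr_ge0 `|x|; have := seminorm_ge0 0 f.
have := normr_ge0 x; rewrite hf => x0 p0 x2 h1 h2 h3 h4.
have h : p 0 f * p 0 f <= p 0 f * `|x| by rewrite -expr2; lra.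
move: p0; rewrite le_eqVlt => /orP[/eqP <-//|p0].
by rewrite ler_pM2l in h.
Qed.

(* A maximizing sequence converges on the points singled out by [K1], hence on [C];
   its limit extends to a maximizer since [energy] is lower semicontinuous for
   pointwise convergence. *)
Lemma gauge_maximizer x : E x -> exists f, gauge x = f x - energy f.
Proof.
move=> Ex; pose M := `|x| + 1.
have M1 : 1 <= M by rewrite lerDr.
have /choice[F hF] : forall k, exists f, gauge x - (2 ^+ k)^-1 <= f x - energy f.
  move=> k; have k0 : 0 < (2 ^+ k)^-1 :> R by rewrite invr_gt0 exprn_gt0.
  by have [_ [f _ <-] hf] := sup_adherent k0 (gauge_has_sup Ex); exists f; exact: ltW.
have tk N k : (N <= k)%N -> gauge x - (2 ^+ N)^-1 <= F k x - energy (F k).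
  move=> Nk; apply: le_trans (hF k); rewrite lerD2l lerN2.
  by rewrite lef_pV2 ?posrE ?exprn_gt0// ler_eXn2l// ltr1n.
have FM k y : E y -> `|F k y| <= M * `|y|.
  move=> Ey; apply: le_trans (seminorm_bound _ Ey) _; rewrite ler_wpM2r//.
  by apply: near_maximizer_bound Ex _; have := tk 0%N k (leq0n k); rewrite expr0 invr1.
have FB y : B y -> forall e : R, 0 < e -> exists N, forall k l, (N <= k)%N -> (N <= l)%N ->
    `|F k y - F l y| < e.
  move=> By e e0; have [n [Ky Kny]] := K1 By.
  have e20 : 0 < e ^+ 2 by rewrite exprn_gt0.
  have [N hN] := dyadic_small (4 * 2 ^+ n) e20; exists N => k l Nk Nl.
  have := near_maximizers_eval Ex Ky Kny (tk _ _ Nk) (tk _ _ Nl).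
  rewrite mulrA => /le_lt_trans/(_ (hN N (leqnn N))).
  by rewrite -[in X in X -> _]real_normK ?num_real// ltr_sqr ?nnegrE// ltW.
have /choice[g hg] : forall y, exists l : R^o, C y -> converges (fun k => F k y : R^o) l.
  move=> y; have [Cy|nCy] := pselect (C y); last by exists 0.
  suff [l hl] : exists l : R^o, converges (fun k => F k y : R^o) l by exists l.
  apply: complete_seq_complete => e e0.
  have [m hm] := dyadic_small `|y| ltr01.
  have Bm : B ((2 ^+ m)^-1 *: y).
    split; first exact: subgroup_dyadic.
    by rewrite normrZ gtr0_norm ?invr_gt0 ?exprn_gt0// mulrC ltW// hm.
  have em : 0 < e / 2 ^+ m by rewrite divr_gt0// exprn_gt0.
  have [N hN] := FB _ Bm _ em; exists N => k l Nk Nl.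
  have := hN k l Nk Nl; rewrite !dualZ -mulrBr normrM.
  by rewrite gtr0_norm ?invr_gt0 ?exprn_gt0// mulrC ltr_pM2r ?invr_gt0 ?exprn_gt0.
have gB y z : C y -> C z -> g (y - z) = g y - g z.
  move=> Cy Cz; apply/eqP; rewrite -subr_eq0 -normr_le0; apply/ler_addgt0Pr => e e0.
  have e3 : 0 < e / 3 by rewrite divr_gt0.
  have [N1 h1] := hg _ Cy _ e3; have [N2 h2] := hg _ Cz _ e3.
  have [N3 h3] := hg _ (CB Cy Cz) _ e3.
  pose N := maxn N1 (maxn N2 N3).
  have := h1 N (leq_maxl _ _); have := h2 N; have := h3 N.
  rewrite /N !leq_max !leqnn !orbT raddfB => /(_ isT) a3 /(_ isT) a2 a1.
  move: a1 a2 a3; rewrite !ltr_norml add0r ler_norml => /andP[? ?] /andP[? ?] /andP[? ?].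
  by apply/andP; split; lra.
have gM y : C y -> g y <= M * `|y|.
  move=> Cy; apply/ler_addgt0Pr => e e0; have [N hN] := hg _ Cy _ e0.
  have := hN N (leqnn N); have := FM N y (subset_adherent Cy).
  by rewrite ler_norml ltr_norml => /andP[? ?] /andP[? ?]; lra.
have [f [fg fM]] := dual_extend (le_trans ler01 M1) C0 CB gB gM.
have fM' y : `|f y| <= M * `|y|.
  rewrite ler_norml fM andbT lerNl -raddfN/=; apply: le_trans (fM _) _.
  by rewrite normrN.
have fC y : C y -> forall e : R, 0 < e -> exists N, forall k, (N <= k)%N -> `|F k y - f y| < e.
  by move=> Cy e e0; have [N hN] := hg _ Cy _ e0; exists N => k Nk; rewrite fg// hN.
have fx (e : R) : 0 < e -> exists N, forall k, (N <= k)%N -> `|F k x - f x| < e.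
  move=> e0; have d0 : 0 < e / (4 * M) by rewrite divr_gt0// mulr_gt0//; lra.
  have [c Cc xc] := Ex _ d0; have e2 : 0 < e / 2 by rewrite divr_gt0.
  have [N hN] := fC _ Cc _ e2; exists N => k /hN h.
  have := FM k _ (adherentB Ex (subset_adherent Cc)); have := fM' (x - c).
  have : M * `|x - c| < e / 4.
    rewrite ltr_pdivlMr in xc; last lra.
    lra.
  move: h; rewrite !raddfB/= ltr_norml !ler_norml => /andP[? ?] ? /andP[? ?] /andP[? ?].
  by rewrite ltr_norml; apply/andP; split; lra.
(* [p n] is a supremum of evaluations at points of [C], where [F k] converges to [f]: it is lower
   semicontinuous. *)
have fp n (e : R) : 0 < e -> exists N, forall k, (N <= k)%N -> p n f <= p n (F k) + e.
  move=> e0; have e2 : 0 < e / 2 by rewrite divr_gt0.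
  have [_ [y Ky <-] hy] := sup_adherent e2 (seminorm_has_sup n f).
  have [N hN] := fC _ (KB Ky).1 _ e2; exists N => k /hN h.
  have := seminorm_ub (F k) Ky; rewrite -/(p n f) in hy.
  by have := ler_distD (F k y) (f y) 0; rewrite !subr0 distrC; lra.
have fS N (e : R) : 0 < e -> exists k0, forall k, (k0 <= k)%N ->
    energy_sum N f <= energy_sum N (F k) + e.
  elim: N e => [|n IH] e e0.
    by exists 0%N => k _; rewrite /energy_sum !big_ord0 add0r ltW.
  have e2 : 0 < e / 2 by rewrite divr_gt0.
  have [k1 h1] := IH _ e2.
  pose d := Num.min 1 (e / 2 / (2 * M + 1)).
  have M20 : 0 < 2 * M + 1 by lra.
  have d0 : 0 < d by rewrite lt_min ltr01 divr_gt0.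
  have [k2 h2] := fp n _ d0.
  exists (maxn k1 k2) => k; rewrite geq_max => /andP[/h1 a1 /h2 a2].
  rewrite !energy_sumS.
  have pM : p n (F k) <= M.
    apply: le_trans (seminorm_le0 _ _) _; apply: near_maximizer_bound Ex _.
    by have := tk 0%N k (leq0n k); rewrite expr0 invr1.
  have d1 : d <= 1 by rewrite ge_min lexx.
  have d2 : d * (2 * M + 1) <= e / 2 by rewrite -ler_pdivlMr// ge_min lexx orbT.
  have a3 : p n f ^+ 2 <= p n (F k) ^+ 2 + e / 2.
    have : p n f ^+ 2 <= (p n (F k) + d) ^+ 2.
      by rewrite ler_sqr ?nnegrE ?seminorm_ge0// addr_ge0 ?seminorm_ge0// ltW.
    by have := seminorm_ge0 n (F k); nra.
  have i0 : 0 < (2 ^+ n)^-1 :> R by rewrite invr_gt0 exprn_gt0.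
  have i1 : (2 ^+ n)^-1 <= 1 :> R by rewrite invf_le1 ?exprn_gt0// exprn_ege1// ler1n.
  nra.
exists f; apply/eqP; rewrite eq_le gauge_ub// andbT.
rewrite lerBrDr addrC -lerBrDr; apply: energy_le => N; apply/ler_addgt0Pr => e e0.
have e3 : 0 < e / 3 by rewrite divr_gt0.
have [k1 h1] := fS N _ e3; have [k2 h2] := fx _ e3; have [k3 h3] := dyadic_small 1 e3.
pose k := maxn k1 (maxn k2 k3).
have := h1 k (leq_maxl _ _); have := h2 k; have := h3 k.
rewrite /k !leq_max !leqnn !orbT -/k => /(_ isT) a3 /(_ isT) a2 a1.
have := hF k; have := energy_ub N (F k); move: a2; rewrite ltr_norml => /andP[? ?].
by rewrite mul1r in a3; lra.
Qed.

(** Choose [K n] by [K2] so that [f] is at most [d] on it. A near-maximizer [g] is then at most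
    [2 * d] on [K n], and within [d] of [f] at the finitely many [r i]. A point of the ball is some
    [r i] plus twice a point of [K n], so [g - f] is at most [d + 2 * (3 * d)], whence
    [d = e / 7]. *)
Lemma maximizer_strong f x (e : R) : E x -> gauge x = f x - energy f -> 0 < e ->
  exists2 t : R, 0 < t & forall g, gauge x - t <= g x - energy g ->
    forall y, E y -> `|g y - f y| <= e * `|y|.
Proof.
move=> Ex hf e0; pose d := e / 7.
have d0 : 0 < d by rewrite divr_gt0.
have [n [fn [I [r [Br rP]]]]] := K2 f d0.
have /choice[m hm] : forall i, exists m, K m (r i) /\ forall y, K m y -> y = 0 \/ y = r i.
  by move=> i; exact: K1.
pose N := maxn n (\max_i m i).
have N0 : 0 < 2 ^+ N :> R by rewrite exprn_gt0.
pose t := d ^+ 2 / (4 * 2 ^+ N).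
have t0 : 0 < t by rewrite divr_gt0 ?exprn_gt0// mulr_gt0.
have tN k : (k <= N)%N -> 4 * (2 ^+ k * t) <= d ^+ 2.
  move=> kN; have -> : d ^+ 2 = 4 * (2 ^+ N * t) by rewrite /t; field; rewrite gt_eqF.
  by rewrite !ler_pM2l// ler_pM2r// ler_eXn2l// ltr1n.
exists t => // g hg y Ey.
have hf' : gauge x - t <= f x - energy f by rewrite -hf gerBl ltW.
have gn : p n g <= 2 * d.
  have := near_maximizers n Ex hf' hg; have := seminorm_mid n f g.
  set c := dual_comb _ _ _ _ => h1 h2.
  have h3 : p n f <= d by exact: seminorm_le.
  have h4 := tN n (leq_maxl _ _).
  have : p n c ^+ 2 <= ((p n f + p n g) / 2) ^+ 2.
    by rewrite ler_sqr ?nnegrE ?divr_ge0 ?addr_ge0 ?seminorm_ge0.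
  move=> h5; have : (p n g - p n f) ^+ 2 <= d ^+ 2 by nra.
  have := seminorm_ge0 n f; have := seminorm_ge0 n g; nra.
have gr i : `|g (r i) - f (r i)| <= d.
  have [Km Km'] := hm i.
  have := near_maximizers_eval Ex Km Km' hg hf'.
  have : (m i <= N)%N by rewrite leq_max (leq_bigmax i) orbT.
  by move=> /tN h /le_trans/(_ h); rewrite -[in X in X -> _]real_normK ?num_real// ler_sqr ?nnegrE// ltW.
pose h := dual_comb 1 (-1) g f.
have hE z : h z = g z - f z by rewrite dual_combE mul1r mulN1r.
rewrite -hE; apply: le_trans (seminorm_bound h Ey) _; rewrite ler_wpM2r//.
apply: seminorm_le => z; rewrite K0 => /rP[i Ki].
have -> : h z = h (r i) + 2 * h (2^-1 *: (z - r i)).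
  by rewrite dualZ raddfB /= mulrA divff// mul1r addrC subrK.
have := gr i; rewrite -hE.
have : `|h (2^-1 *: (z - r i))| <= 3 * d.
  rewrite hE; have := seminorm_ub g Ki; have := fn _ Ki.
  by rewrite !ler_norml => /andP[? ?] /andP[? ?]; apply/andP; split; lra.
rewrite !ler_norml => /andP[? ?] /andP[? ?]; have -> : e = 7 * d by rewrite /d; field.
by apply/andP; split; lra.
Qed.

(** A maximizer [g] at [x + y] is a near-maximizer at [x]: it loses at most
    [(2 * |x| + 1) * |y| < t]. Hence [g] is close to [f] in norm, while
    [gauge (x + y) <= gauge x + g y]. *)
Lemma gauge_upper_estimate f x (e : R) : E x -> gauge x = f x - energy f -> 0 < e ->
  exists2 d : R, 0 < d & forall y, E y -> `|y| < d ->
    gauge (x + y) <= gauge x + f y + e * `|y|.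
Proof.
move=> Ex hf e0; have [t t0 ht] := maximizer_strong Ex hf e0.
have x1 : 0 < 2 * `|x| + 1 by rewrite ltr_wpDl// mulr_ge0.
exists (Num.min 1 (t / (2 * `|x| + 1))); first by rewrite lt_min ltr01 divr_gt0.
move=> y Ey; rewrite lt_min => /andP[y1]; rewrite ltr_pdivlMr// => yt.
have Exy : E (x + y) by exact: adherentD.
have [g hg] := gauge_maximizer Exy.
have gxy := maximizer_bound Exy hg; have fx := maximizer_bound Ex hf.
have gy := seminorm_bound g Ey; have fy := seminorm_bound f Ey.
have fxy := gauge_ub f Exy; rewrite raddfD/= in fxy; rewrite raddfD/= in hg.
have b1 : p 0 g * `|y| <= (`|x| + 1) * `|y|.
  rewrite ler_wpM2r//; apply: le_trans gxy _; apply: le_trans (ler_normD _ _) _.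
  by rewrite lerD2l ltW.
have b2 : p 0 f * `|y| <= `|x| * `|y| by rewrite ler_wpM2r.
have := ler_norm (g y); have := ler_norm (- f y); rewrite normrN => n1 n2.
have gt : gauge x - t <= g x - energy g by lra.
have := gauge_ub g Ex; have := ht g gt y Ey; rewrite ler_norml => /andP[? ?]; lra.
Qed.

(** [D x] is a maximizer in the conjugate that defines [Q x]. The fourth clause makes it a
    subgradient and, with the fifth, the Frechet derivative of [Q] along [E]. *)
Theorem smooth_gauge : exists (Q : Z -> R) (D : Z -> dual Z),
  [/\ forall x, E x -> `|x| ^+ 2 / 8 <= Q x <= `|x| ^+ 2 / 4,
      forall x y, E x -> E y -> `|D x y| <= `|x| * `|y|,
      forall x, E x -> Q x <= D x x,
      forall x y, E x -> E y -> D x y <= Q (x + y) - Q x &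
      forall x (e : R), E x -> 0 < e -> exists2 d : R, 0 < d &
        forall y, E y -> `|y| < d -> Q (x + y) <= Q x + D x y + e * `|y|].
Proof.
have /choice[D hD] : forall x, exists f, E x -> gauge x = f x - energy f.
  move=> x; have [Ex|nEx] := pselect (E x).
    by have [f hf] := gauge_maximizer Ex; exists f.
  by have [f _] := norming_functional x; exists f.
exists gauge, D; split.
- by move=> x Ex; rewrite gauge_ge// gauge_le.
- move=> x y Ex Ey; apply: le_trans (seminorm_bound _ Ey) _.
  by rewrite ler_wpM2r//; apply: maximizer_bound (hD x Ex).
- by move=> x Ex; rewrite (hD x Ex) gerBl energy_ge0.
- move=> x y Ex Ey; have := gauge_ub (D x) (adherentD Ex Ey); rewrite raddfD/=.
  by have := hD x Ex; lra.
- by move=> x e Ex e0; exact: gauge_upper_estimate (hD x Ex) e0.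
Qed.

End SmoothGauge.

(** * Separable duals *)

(** Each stage [e n.+1] decodes an index either as an element of stage [n] or as an order to compute
    the [l]-th output of an operation on two elements of that stage; [c] enumerates all stages. *)
Lemma countable_closure (T : eqType) (Phi : nat -> T -> T -> seq T) (c0 : nat -> T) :
  exists c : nat -> T, range c0 `<=` range c /\
    forall n x y z, range c x -> range c y -> z \in Phi n x y -> range c z.
Proof.
pose step (e : nat -> T) k := match @unpickle (nat + (nat * nat) * (nat * nat))%type k with
  | Some (inl j) => e j
  | Some (inr ((n, i), (j, l))) => nth (c0 0%N) (Phi n (e i) (e j)) l
  | None => c0 0%N
  end.
pose e n := iter n step c0.
pose c k := match @unpickle (nat * nat)%type k with
  | Some (n, j) => e n j
  | None => c0 0%N
  end.
have ec n j : range c (e n j) by exists (pickle (n, j)) => //; rewrite /c pickleK.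
have emono n m : (n <= m)%N -> range (e n) `<=` range (e m).
  move=> /subnK <-; elim: (m - n)%N => [//|k IH] x /IH[j _ <-].
  exists (pickle (inl j : nat + (nat * nat) * (nat * nat))%type) => //.
  by rewrite addSn /e iterS {1}/step pickleK.
have ce x : range c x -> exists n, range (e n) x.
  move=> [k _ <-]; rewrite /c; case: unpickle => [[n j]|]; first by exists n, j.
  by exists 0%N, 0%N.
exists c; split=> [x [j _ <-]|n x y z /ce[n1 e1] /ce[n2 e2]].
  by have := ec 0%N j.
move=> zP.
have [i _ ix] := emono _ _ (leq_maxl n1 n2) _ e1.
have [j _ jy] := emono _ _ (leq_maxr n1 n2) _ e2.
pose l := index z (Phi n x y).
suff <- : e (maxn n1 n2).+1
  (pickle (inr ((n, i), (j, l)) : nat + (nat * nat) * (nat * nat))%type) = z by exact: ec.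
by rewrite /e iterS {1}/step pickleK -/(e _) ix jy nth_index.
Qed.

Lemma prod_norm_fst {R : realType} {X Y : normedModType R} (z : X * Y) : `|z.1| <= `|z|.
Proof. by rewrite [leRHS]prod_normE le_max lexx. Qed.

Lemma prod_norm_snd {R : realType} {X Y : normedModType R} (z : X * Y) : `|z.2| <= `|z|.
Proof. by rewrite [leRHS]prod_normE le_max lexx orbT. Qed.

(** * Components of a functional on a product space *)

Section DualComponents.
Context {R : realType} {X Y : normedModType R}.
Variable f : dual (X * Y)%type.

Definition dual_inl_fun (x : X) : R^o := f (x, 0).
Definition dual_inr_fun (y : Y) : R^o := f (0, y).

Lemma dual_inl_linear : linear dual_inl_fun.
Proof.
move=> a x y; rewrite /dual_inl_fun -linearP; congr (f _).
by apply/pair_equal_spec; split; rewrite //= scaler0 addr0.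
Qed.

Lemma dual_inr_linear : linear dual_inr_fun.
Proof.
move=> a x y; rewrite /dual_inr_fun -linearP; congr (f _).
by apply/pair_equal_spec; split; rewrite //= scaler0 addr0.
Qed.

HB.instance Definition _ :=
  GRing.isLinear.Build R X R^o *:%R dual_inl_fun dual_inl_linear.
HB.instance Definition _ :=
  GRing.isLinear.Build R Y R^o *:%R dual_inr_fun dual_inr_linear.

Lemma dual_inl_continuous : continuous dual_inl_fun.
Proof.
have [M M0 fM] := dual_bounded f.
apply: (dominated_linear_continuous (M := M)) => x.
by apply: le_trans (fM _) _; rewrite prod_normE/= normr0 max_l.
Qed.

Lemma dual_inr_continuous : continuous dual_inr_fun.
Proof.
have [M M0 fM] := dual_bounded f.
apply: (dominated_linear_continuous (M := M)) => x.
by apply: le_trans (fM _) _; rewrite prod_normE/= normr0 max_r.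
Qed.

Definition dual_inl : dual X := Dual dual_inl_continuous.
Definition dual_inr : dual Y := Dual dual_inr_continuous.

Lemma dual_prodE z : f z = dual_inl z.1 + dual_inr z.2.
Proof.
rewrite /= /dual_inl_fun /dual_inr_fun -raddfD; congr (f _); case: z => x y.
by apply/pair_equal_spec; split; rewrite /= ?addr0 ?add0r.
Qed.

End DualComponents.

Section DualSeparable.
Context {R : realType}.

(* By the Hahn-Banach theorem, this says that the dual of every separable
   subspace is separable. *)
Definition dual_separable (Z : normedModType R) :=
  forall c : nat -> Z, exists F : nat -> dual Z,
    forall (f : dual Z) (e : R), 0 < e ->
      exists n, forall k, `|f (c k) - F n (c k)| <= e * `|c k|.

Theorem smooth_gauge_separable (Z : normedModType R) (C : set Z) (c : nat -> Z) :
  dual_separable Z -> C = range c -> C 0 ->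
  (forall x y, C x -> C y -> C (x - y)) -> (forall x, C x -> C (2^-1 *: x)) ->
  exists (Q : Z -> R) (D : Z -> dual Z),
  [/\ forall x, adherent C x -> `|x| ^+ 2 / 8 <= Q x <= `|x| ^+ 2 / 4,
      forall x y, adherent C x -> adherent C y -> `|D x y| <= `|x| * `|y|,
      forall x, adherent C x -> Q x <= D x x,
      forall x y, adherent C x -> adherent C y -> D x y <= Q (x + y) - Q x &
      forall x (e : R), adherent C x -> 0 < e -> exists2 d : R, 0 < d &
        forall y, adherent C y -> `|y| < d -> Q (x + y) <= Q x + D x y + e * `|y|].
Proof.
move=> dZ CE C0 CB CH; have [F hF] := dZ c.
pose B := [set x | C x /\ `|x| <= 1].
have B0 : B 0 by split; rewrite ?normr0.
(* Index [2k + 1] isolates the point [c k]; index [2k + 2] asks [F 0, ..., F k] to be at most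
   [1 / (k + 1)]. The latter sets give [K2]: some [F n] is close to [f] on [C], and [finite_net]
   applied to the values of these functionals covers the ball. *)
pose K n := if n is m.+1 then
    if odd m then [set x | B x /\ forall i, (i <= m./2)%N -> `|F i x| <= (m./2).+1%:R^-1]
    else [set x | B x /\ (x = 0 \/ x = c m./2)]
  else B.
apply: (@smooth_gauge R Z C K) => //.
- by case=> [//|n] x /=; case: ifP => _ [].
- case=> [//|n] /=; case: ifP => _; split => //; last by left.
  by move=> i _; rewrite raddf0 normr0 invr_ge0.
- move=> x Bx; have := Bx.1; rewrite CE => -[k _ kx].
  exists k.*2.+1; rewrite /= odd_double/= doubleK kx.
  split; first by split=> //; right.
  by move=> y [].
- move=> f e e0.
  have e2 : 0 < e / 2 by rewrite divr_gt0.
  have [n hn] := hF f _ e2.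
  have [k hk] := ltr_natP (2 / e).
  pose m := maxn n k.
  have me : m.+1%:R^-1 <= e / 2.
    rewrite -[e / 2]invf_div lef_pV2 ?posrE ?divr_gt0//.
    by apply: ltW; apply: lt_le_trans hk _; rewrite ler_nat ltnS leq_maxr.
  have KE : K m.*2.+2 = [set x | B x /\ forall i, (i <= m)%N -> `|F i x| <= m.+1%:R^-1].
    by rewrite /K /= odd_double/= uphalf_double.
  exists m.*2.+2; rewrite KE; split.
    move=> x [[Cx x1] /(_ n (leq_maxl _ _))/le_trans/(_ me) Fx].
    have := Cx; rewrite CE => -[j _ jx]; have := hn j; rewrite jx.
    have := ler_distD (F n x) (f x) 0; rewrite !subr0.
    have : e / 2 * `|x| <= e / 2 by rewrite ler_piMr// ltW.
    lra.
  have [M hM] : exists M : R, forall i x, (i <= m)%N -> B x -> `|F i x| <= M.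
    elim: m {me KE} => [|m [M hM]].
      have [M M0 h] := dual_bounded (F 0%N); exists M => i x; rewrite leqn0 => /eqP -> [_ x1].
      by apply: le_trans (h x) _; rewrite ler_piMr// ltW.
    have [M' M0 h] := dual_bounded (F m.+1); exists (Num.max M M') => i x.
    rewrite leq_eqVlt ltnS le_max => /orP[/eqP ->|im] Bx; last by rewrite hM.
    by apply/orP; right; apply: le_trans (h x) _; rewrite ler_piMr ?Bx.2// ltW.
  have m0 : 0 < m.+1%:R^-1 :> R by rewrite invr_gt0.
  have [I [r [Br rP]]] := finite_net (g := fun i x => F i x) B0 m0 hM.
  exists I, r; split=> // x Bx; have [i hi] := rP x Bx; exists i; split.
    split; first by apply/CH/CB; [exact: Bx.1|exact: (Br i).1].
    rewrite normrZ ger0_norm//; have := ler_normB x (r i).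
    by have := Bx.2; have := (Br i).2; lra.
  move=> j /hi h; rewrite dualZ raddfB/= normrM ger0_norm//.
  by apply: le_trans h; rewrite ler_piMl// invf_le1// ler1n.
Qed.

(** Products are formed at this level, where a functional splits into its two components, rather
    than for [asplund]. *)
Lemma dual_separable_prod (X Y : normedModType R) :
  dual_separable X -> dual_separable Y -> dual_separable (X * Y)%type.
Proof.
move=> dX dY c; have [F hF] := dX (fst \o c); have [G hG] := dY (snd \o c).
exists (fun n => if @unpickle (nat * nat)%type n is Some (i, j)
  then dual_pair (F i) (G j) else dual_pair (F 0%N) (G 0%N)) => f e e0.
have e2 : 0 < e / 2 by rewrite divr_gt0.
have [i hi] := hF (dual_inl f) _ e2; have [j hj] := hG (dual_inr f) _ e2.
exists (pickle (i, j)) => k; rewrite pickleK.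
rewrite [f _]dual_prodE.
have := hi k; have := hj k; rewrite /= /dual_pair_fun /=.
have := prod_norm_fst (c k); have := prod_norm_snd (c k).
rewrite opprD addrACA => n2 n1 h2 h1; apply: le_trans (ler_normD _ _) _.
nra.
Qed.

Lemma seq_complete_prod (X Y : normedModType R) :
  @seq_complete R X -> @seq_complete R Y -> @seq_complete R (X * Y)%type.
Proof.
move=> cX cY u uC.
have [|l1 h1] := cX (fst \o u).
  move=> e /uC[N hN]; exists N => m n Nm Nn.
  exact: le_lt_trans (prod_norm_fst (u m - u n)) (hN m n Nm Nn).
have [|l2 h2] := cY (snd \o u).
  move=> e /uC[N hN]; exists N => m n Nm Nn.
  exact: le_lt_trans (prod_norm_snd (u m - u n)) (hN m n Nm Nn).
exists (l1, l2) => e e0; have [N1 hN1] := h1 e e0; have [N2 hN2] := h2 e e0.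
exists (maxn N1 N2) => n; rewrite geq_max => /andP[/hN1 a1 /hN2 a2].
by rewrite prod_normE/= gt_max a1.
Qed.

Lemma adherent_idem (Z : normedModType R) (C : set Z) x :
  adherent (adherent C) x -> adherent C x.
Proof.
move=> Cx e e0; have e2 : 0 < e / 2 by rewrite divr_gt0.
have [y Cy xy] := Cx _ e2; have [c Cc yc] := Cy _ e2; exists c => //.
by have := ler_distD y x c; lra.
Qed.

Lemma adherent_closure (Z : normedModType R) (C : set Z) : adherent C = closure C.
Proof.
apply/seteqP; split=> x Cx.
  move=> A /nbhs_ballP[_ /posnumP[e] eA]; have [c Cc xc] := Cx _ (gt0 e).
  by exists c; split=> //; apply: eA; rewrite -ball_normE.
move=> e e0; have [c [Cc xc]] := Cx _ (nbhsx_ballx x e e0).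
by exists c => //; move: xc; rewrite -ball_normE.
Qed.

Lemma closed_adherent (Z : normedModType R) (S : set Z) x :
  closed S -> adherent S x -> S x.
Proof. by move=> /closure_id {2}->; rewrite adherent_closure. Qed.

(** The closure is stable under dyadic multiples, and these approximate every real multiple. *)
Lemma adherent_scale (Z : normedModType R) (C : set Z) a x :
  C 0 -> (forall x y, C x -> C y -> C (x - y)) -> (forall x, C x -> C (2^-1 *: x)) ->
  adherent C x -> adherent C (a *: x).
Proof.
move=> C0 CB CH Ex.
have E0 : adherent C 0 by exact: subset_adherent.
have EB := adherentB CB.
have EH z : adherent C z -> adherent C (2^-1 *: z).
  move=> Ez e e0; have [c Cc zc] := Ez e e0; exists (2^-1 *: c); first exact: CH.
  rewrite -scalerBr normrZ ger0_norm//; apply: le_lt_trans zc.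
  by rewrite ler_piMl// invf_le1// ler1n.
wlog a0 : a / 0 <= a.
  move=> h; have [/h//|/ltW a0] := leP 0 a.
  rewrite -[a *: x]opprK -scaleNr -sub0r; apply: EB => //; apply: h.
  by rewrite oppr_ge0.
apply: adherent_idem => e e0; have [m hm] := dyadic_small `|x| e0.
have {}hm := hm m (leqnn m).
have m0 : 0 < 2 ^+ m :> R by rewrite exprn_gt0.
pose k := Num.trunc (a * 2 ^+ m).
have /truncn_itv/andP[k1 k2] : 0 <= a * 2 ^+ m by rewrite mulr_ge0// ltW.
rewrite -/k -[k.+1%:R]natr1 in k1 k2.
exists ((2 ^+ m)^-1 *: (k%:R *: x)).
  by apply: (subgroup_dyadic EH); apply: (subgroupMn E0 EB).
rewrite scalerA -scalerBl normrZ; apply: le_lt_trans hm.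
rewrite mulrC ler_wpM2l// -[leRHS]mul1r -ler_pdivrMr ?invr_gt0// invrK.
rewrite -{2}[2 ^+ m]gtr0_norm// -normrM mulrBl mulrAC mulVf ?gt_eqF// mul1r.
by rewrite ler_norml; apply/andP; split; lra.
Qed.

Lemma subspace_dual_bounded (Z : normedModType R) (E : set Z) (f : Z -> R) :
  linear_subspace E -> subspace_dual E f ->
  f 0 = 0 /\ exists2 M : R, 0 < M & forall x, E x -> `|f x| <= M * `|x|.
Proof.
move=> [E0 EL] [fL /subspace_continuousP/(_ _ E0) f0].
have fz : f 0 = 0.
  by have := fL 1 _ _ E0 E0; rewrite scaler0 addr0 mul1r => h; lra.
split=> //; move/cvgrPdist_lt : f0 => /(_ _ ltr01); rewrite near_withinE.
move=> /nbhs_ballP[_ /posnumP[d] df]; exists (2 / d%:num); first by rewrite divr_gt0.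
move=> x Ex; have [->|x0] := eqVneq x 0; first by rewrite fz !normr0 mulr0.
have x0' : 0 < `|x| by rewrite normr_gt0.
pose t := d%:num / 2 / `|x|.
have t0 : 0 < t by rewrite !divr_gt0.
have Et : E (t *: x) by rewrite -[t *: x]addr0; exact: EL.
have := df (t *: x); rewrite -ball_normE /= sub0r normrN normrZ gtr0_norm//.
rewrite /t divfK ?gt_eqF// ltr_pdivrMr// ltr_pMr// ltr1n => /(_ isT Et) h.
have {h} : `|f 0 - f (t *: x)| < 1 := h.
rewrite fz sub0r normrN -[t *: x]addr0 fL// fz addr0 normrM gtr0_norm//.
rewrite /t -mulrA mulrC -ltr_pdivlMr// invf_div mul1r => /ltW.
by rewrite mulrC ler_pdivrMr.
Qed.

(** The given points are enclosed in a countable subgroup stable under halving, whose closure is a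
    separable subspace. The countably many functionals supplied by [asplund] live on that subspace
    and are extended by [dual_extend]. *)
Lemma asplund_dual_separable (X : completeNormedModType R) :
  asplund X -> dual_separable X.
Proof.
move=> aX c0.
have [c [c0c cC]] := countable_closure (fun _ x y => [:: x - y; 2^-1 *: x]) c0.
pose C := range c; pose E := adherent C.
have CB x y : C x -> C y -> C (x - y).
  by move=> Cx Cy; apply: (cC 0%N _ _ _ Cx Cy); rewrite !inE eqxx.
have CH x : C x -> C (2^-1 *: x).
  by move=> Cx; apply: (cC 0%N _ _ _ Cx Cx); rewrite !inE eqxx orbT.
have C0 : C 0 by have := CB (c 0%N) (c 0%N); rewrite subrr; apply; exists 0%N.
have EL : linear_subspace E.
  split; first exact: subset_adherent.
  by move=> a x y Ex Ey; apply: adherentD => //; exact: adherent_scale.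
have [|D [/countable_injP[i iI] DE Dd]] := aX _ EL.
  exists C; split.
  - by apply: card_le_trans (card_image_le _ _) _; exact: countableP.
  - by move=> x; exact: subset_adherent.
  - by rewrite -adherent_closure.
(* [gen] lists [D] through its injection [i] into the naturals; an index outside the range gives the
   zero function. *)
pose gen n := xget (fun=> 0) [set g | D g /\ i g = n].
have /choice[F hF] : forall n, exists f : dual X, subspace_dual E (gen n) ->
    forall x, E x -> f x = gen n x.
  move=> n; have [h|h] := pselect (subspace_dual E (gen n)); last first.
    by have [f _] := norming_functional (0 : X); exists f => /h.
  have [g0 [M M0 gM]] := subspace_dual_bounded EL h.
  have [||||f [fg _]] := @dual_extend _ _ E (gen n) M (ltW M0).
  - exact: EL.1.
  - exact: adherentB.
  - move=> x y Ex Ey; rewrite -[x - y]addrC -scaleN1r h.1//.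
    by rewrite mulN1r addrC.
  - by move=> x /gM; exact: le_trans (ler_norm _).
  by exists f => _.
exists F => f e e0.
have fE : subspace_dual E f.
  split; first by move=> a x y _ _; rewrite linearP.
  by apply: continuous_subspaceT; exact: dual_continuous.
have [g Dg hg] := Dd f fE e e0.
have gE := DE _ Dg.
have geng : gen (i g) = g.
  rewrite /gen; case: xgetP => [h _ [Dh hi]|/(_ g) []//].
  by apply: iI => //; rewrite inE.
exists (i g) => k.
have Ek : E (c0 k) by apply: subset_adherent; apply: c0c; exists k.
rewrite hF ?geng //.
have [f0 [M M0 fM]] := subspace_dual_bounded EL fE.
have [g0 [M' M'0 gM]] := subspace_dual_bounded EL gE.
have [->|x0] := eqVneq (c0 k) 0; first by rewrite f0 g0 subrr !normr0 mulr0.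
have x0' : 0 < `|c0 k| by rewrite normr_gt0.
have Eu : E (`|c0 k|^-1 *: c0 k) by rewrite -[_ *: _]addr0; apply: EL.2 => //; exact: EL.1.
have : `|(f \- g) (`|c0 k|^-1 *: c0 k)| <= dual_norm_on E (f \- g).
  apply: ub_le_sup; last first.
    exists (`|c0 k|^-1 *: c0 k) => //; split=> //=.
    by rewrite normrZ ger0_norm ?invr_ge0// mulVf ?gt_eqF.
  exists (M + M') => _ [z [Ez /= z1] <-].
  apply: le_trans (ler_normB _ _) _; apply: lerD.
    by apply: le_trans (fM _ Ez) _; rewrite ler_piMr// ltW.
  by apply: le_trans (gM _ Ez) _; rewrite ler_piMr// ltW.
move=> /le_lt_trans/(_ hg) /=; rewrite -[_ *: _]addr0 gE.1//; last exact: EL.1.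
rewrite raddfD/= dualZ raddf0 g0 !addr0 -mulrBr normrM ger0_norm ?invr_ge0//.
by rewrite mulrC ltr_pdivrMr// => /ltW.
Qed.

End DualSeparable.

(** * Separable reduction *)

Section SeparableReduction.
Context {R : realType} {Z : normedModType R}.
Variables (S : set Z) (p : Z -> R) (L kappa : R).
Hypothesis hp : sublinear p.
Hypothesis L0 : 0 < L.
Hypothesis pL : forall x, p x <= L * `|x|.
Implicit Types t : seq ((nat * nat) * Z).

Local Notation dy n := ((2 ^+ n)^-1 : R).

Lemma dy_gt0 n : 0 < dy n. Proof. by rewrite invr_gt0 exprn_gt0. Qed.

Lemma dyS n : dy n.+1 + dy n.+1 = dy n.
Proof. by rewrite exprS invfM -mulrDl -[in LHS]div1r -splitr mul1r. Qed.

Lemma dy_le n m : (n <= m)%N -> dy m <= dy n.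
Proof. by move=> nm; rewrite lef_pV2 ?posrE ?exprn_gt0// ler_eXn2l// ltr1n. Qed.

(** An entry [((n, m), s)] stands for the inequality [f (s - x) <= 2^-n * |s - x|], imposed for [s]
    within [2^-m] of [x]. Summed over [t], these read [f (disp x t) <= cost x t]. *)
Definition disp x t := \sum_(s <- t) (s.2 - x).
Definition cost x t := \sum_(s <- t) dy s.1.1 * `|s.2 - x|.

Lemma disp_cons x s t : disp x (s :: t) = s.2 - x + disp x t.
Proof. exact: big_cons. Qed.

Lemma cost_cons x s t : cost x (s :: t) = dy s.1.1 * `|s.2 - x| + cost x t.
Proof. exact: big_cons. Qed.

(* [violation x H q m t]: the points [t] certify that no linear functional
   dominated by [p] is at least [kappa * `|H|] at [H] while satisfying, at the
   points of [S] listed in [t], the inequalities that define a Frechet normal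
   to [S] at [x]; [q] measures the margin. *)
Definition violation x H (q : R) (m : nat) t :=
  (forall s, s \in t -> S s.2 /\ `|s.2 - x| < dy s.1.2) /\
  p (m%:R *: H - disp x t) + q < m%:R * (kappa * `|H|) - cost x t.

Lemma disp_change x y t : disp y t = disp x t + (size t)%:R *: (x - y).
Proof.
elim: t => [|s t IH]; first by rewrite /disp !big_nil scale0r addr0.
rewrite !disp_cons IH /= -[(size t).+1%:R]natr1 scalerDl scale1r.
have -> : s.2 - y = (s.2 - x) + (x - y) by rewrite addrA subrK.
by rewrite addrACA [x - y + _]addrC.
Qed.

Lemma cost_shift x y t : cost y t <= cost x t + (size t)%:R * `|x - y|.
Proof.
elim: t => [|s t IH]; first by rewrite /cost !big_nil mul0r addr0.
rewrite !cost_cons /= -[(size t).+1%:R]natr1 mulrDl mul1r.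
have d1 : dy s.1.1 <= 1 by rewrite invf_le1 ?exprn_gt0// exprn_ege1// ler1n.
have := ler_distD x s.2 y; have := normr_ge0 (x - y); have := dy_gt0 s.1.1.
nra.
Qed.

Lemma disp_shift x y v t :
  p (v - disp y t) <= p (v - disp x t) + L * ((size t)%:R * `|x - y|).
Proof.
have -> : v - disp y t = (v - disp x t) + (- ((size t)%:R *: (x - y))).
  by rewrite (disp_change x) opprD addrA.
apply: le_trans (hp.1 _ _) _; rewrite lerD2l; apply: le_trans (pL _) _.
by rewrite normrN normrZ ger0_norm.
Qed.

Variables (C : set Z).
Hypothesis C0 : C 0.
Hypothesis CB : forall x y, C x -> C y -> C (x - y).
Hypothesis CV : forall x H r m t, C x -> C H -> violation x H (dy r) m t ->
  exists t', [/\ map fst t' = map fst t, violation x H (dy r) m t' &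
    forall s, s \in t' -> C s.2].
Variables (w H : Z) (k : dual Z).
Let E := adherent C.
Hypothesis Ew : E w.
Hypothesis CH : C H.
Hypothesis kH : kappa * `|H| <= k H.
Hypothesis kp : forall x, E x -> k x <= p x.
Hypothesis kn : forall n, exists m, forall s, S s -> E s -> `|s - w| < dy m ->
  k (s - w) <= dy n * `|s - w|.

(* By the Mazur-Orlicz theorem, only a [violation] at [w] can prevent the
   existence of [f]. Moving its base point from [w] to a point of [C], then its
   points to points of [C] by [CV], contradicts the existence of [k] on [E]. *)
Theorem frechet_normal_lift : exists f : dual Z,
  [/\ forall x, f x <= p x, kappa * `|H| <= f H &
    forall n, exists m, forall s, S s -> `|s - w| < dy m ->
      f (s - w) <= dy n * `|s - w|].
Proof.
have /choice[md hmd] := kn.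
(* The radius is halved twice below the one at which [kn] applies: the entry records half of it, so
   that the points found by [CV] are still usable seen from [w], and [s] itself lies within a
   quarter, so that the base point can move to [C]. *)
pose good t := forall s, s \in t -> [/\ S s.2, s.1.2 = (md s.1.1).+1 &
  `|s.2 - w| < dy s.1.2.+1].
pose T := [set v : Z * R | exists m t, good t /\
  v = (m%:R *: H - disp w t, m%:R * (kappa * `|H|) - cost w t)].
have [|||f [fp fT]] := mazur_orlicz (T := T) hp pL.
- exists 0%N, [::]; split=> [s|]; first by rewrite in_nil.
  by rewrite /disp /cost !big_nil scale0r mul0r !subr0.
- move=> _ _ [m [t [gt ->]]] [n [u [gu ->]]]; exists (m + n)%N, (t ++ u).
  split; first by move=> s; rewrite mem_cat => /orP[/gt|/gu].
  rewrite /disp /cost !big_cat/= natrD scalerDl mulrDl !opprD.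
  by congr (_, _); rewrite /= addrACA.
- move=> _ [m [t [gt ->]]] /=; apply: contrapT => /negP; rewrite -ltNge => lt.
  pose g := m%:R * (kappa * `|H|) - cost w t - p (m%:R *: H - disp w t).
  have g0 : 0 < g by rewrite subr_gt0.
  (* Of the gap [g], one [dy r] pays for moving the base point from [w] to [x]; the other is the
     margin kept in [violation], which pays for moving back. *)
  have [r hr] := dyadic_small 2 g0; have {}hr := hr r (leqnn r).
  pose K := \sum_(s <- t) s.1.2.+1.
  have KP s : s \in t -> (s.1.2.+1 <= K)%N.
    by move=> st; rewrite /K (big_rem s)//= leq_addr.
  pose N := size t.
  have LN : 0 < (L + 1) * N.+1%:R by rewrite mulr_gt0// addr_gt0.
  pose tau := Num.min (dy K) (dy r / ((L + 1) * N.+1%:R)).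
  have tau0 : 0 < tau by rewrite lt_min dy_gt0 divr_gt0// dy_gt0.
  have [x Cx wx] := Ew tau0.
  have wxK : `|w - x| < dy K by move: wx; rewrite lt_min => /andP[].
  have wxr : (L + 1) * (N%:R * `|w - x|) <= dy r.
    move: wx; rewrite lt_min => /andP[_]; rewrite ltr_pdivlMr// -[N.+1%:R]natr1.
    have : 0 <= (L + 1) * `|w - x| by rewrite mulr_ge0 ?addr_ge0// ltW.
    move=> a0 a1; nra.
  have V : violation x H (dy r) m t.
    split=> [s st|].
      have [Ss s12 sw] := gt s st; split=> //.
      have := ler_distD w s.2 x; have := dyS s.1.2.
      have := dy_le (KP s st); lra.
    have := cost_shift w x t; have := disp_shift w x (m%:R *: H) t.
    rewrite -/N; rewrite /g in hr; lra.
  (* The numerical data are unchanged, so the radii and slopes of [good] still apply, and the points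
     now lie in [C], where [k] is controlled. *)
  have [t' [tt' [V1 V2] Ct']] := CV Cx CH V.
  have sz : size t' = N by rewrite /N -(size_map fst t) -tt' size_map.
  have t'P s : s \in t' -> [/\ S s.2, E s.2 & k (s.2 - w) <= dy s.1.1 * `|s.2 - w|].
    move=> st; have [Ss sx] := V1 s st; have Es := subset_adherent (Ct' s st).
    split=> //; apply: hmd => //.
    have : s.1 \in map fst t by rewrite -tt' map_f.
    move=> /mapP[s' s't ss']; have [_ s12 _] := gt s' s't.
    have := KP s' s't; rewrite -ss' => /dy_le; rewrite -ss' in s12.
    have := ler_distD x s.2 w; have := dyS (md s.1.1); rewrite -s12 in sx *.
    have := dyS s.1.2; have := dy_gt0 s.1.2.+1; rewrite (distrC x w); lra.
  have kd : k (m%:R *: H - disp w t') >= m%:R * (kappa * `|H|) - cost w t'.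
    rewrite raddfB/= dualZ; apply: lerB; first by rewrite ler_wpM2l.
    rewrite /disp /cost raddf_sum/= big_seq [leRHS]big_seq; apply: ler_sum => s st.
    by have [] := t'P s st.
  have Ed : E (m%:R *: H - disp w t').
    apply: (adherentB CB); first by apply: subset_adherent; apply: (subgroupMn C0 CB).
    rewrite /disp big_seq; elim/big_ind : _.
    - exact: subset_adherent.
    - by move=> ? ? ? ?; apply: (adherentD C0 CB).
    - by move=> s st; apply: (adherentB CB) => //; have [] := t'P s st.
  have := kp Ed; have := cost_shift x w t'; have := disp_shift x w (m%:R *: H) t'.
  rewrite sz (distrC x w); lra.
exists f; split=> //.
  apply: (fT (H, kappa * `|H|)); exists 1%N, [::]; split=> [s|]; first by rewrite in_nil.
  by rewrite /disp /cost !big_nil scale1r mul1r !subr0.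
move=> n; exists (md n).+2 => s Ss sw.
have /fT /= : T (0%:R *: H - disp w [:: ((n, (md n).+1), s)],
    0%:R * (kappa * `|H|) - cost w [:: ((n, (md n).+1), s)]).
  by exists 0%N, [:: ((n, (md n).+1), s)]; split => // s'; rewrite inE => /eqP ->.
by rewrite /disp /cost !big_seq1 scale0r mul0r !sub0r raddfN/= lerN2.
Qed.

End SeparableReduction.

(** * Normals near almost minimal points *)

Section Projection.
Context {R : realType} {Z : normedModType R}.
Variables (J : {linear Z -> Z}) (w0 : Z).
Hypothesis JJ : forall x, J (J x) = J x.
Hypothesis JL : forall x, `|J x| <= 2 * `|x|.
Hypothesis Jw0 : J w0 = w0.

Definition proj_bound (tau : R) (x : Z) : R := 2 * `|J x| + tau * `|x|.

Lemma proj_bound_sublinear tau : 0 <= tau -> sublinear (proj_bound tau).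
Proof.
move=> t0; split=> [x y|t x tp]; rewrite /proj_bound.
  rewrite raddfD/=; have := ler_normD (J x) (J y); have := ler_normD x y => h1 h2.
  have := ler_wpM2l t0 h1; lra.
by rewrite linearZ/= !normrZ ger0_norm//; ring.
Qed.

Lemma proj_bound_le tau x : proj_bound tau x <= (4 + tau) * `|x|.
Proof. by rewrite /proj_bound; have := JL x; lra. Qed.

Lemma proj_boundN tau x : proj_bound tau (- x) = proj_bound tau x.
Proof. by rewrite /proj_bound raddfN/= !normrN. Qed.

Section Frechet.
Variables (S C : set Z) (Q : Z -> R) (D : Z -> dual Z).
Let E := adherent C.
Hypothesis cZ : @seq_complete R Z.
Hypothesis Scl : forall x, adherent S x -> S x.
Hypothesis C0 : C 0.
Hypothesis CB : forall x y, C x -> C y -> C (x - y).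
Hypothesis CJ : forall x, C x -> C (J x).
Hypothesis Cw0 : C w0.
Hypothesis Qb : forall x, E x -> `|x| ^+ 2 / 8 <= Q x <= `|x| ^+ 2 / 4.
Hypothesis Db : forall x y, E x -> E y -> `|D x y| <= `|x| * `|y|.
Hypothesis QD : forall x, E x -> Q x <= D x x.
Hypothesis Dsub : forall x y, E x -> E y -> D x y <= Q (x + y) - Q x.
Hypothesis Dfre : forall x (e : R), E x -> 0 < e -> exists2 d : R, 0 < d &
  forall y, E y -> `|y| < d -> Q (x + y) <= Q x + D x y + e * `|y|.

Lemma adherentJ x : E x -> E (J x).
Proof.
move=> Ex e e0; have e2 : 0 < e / 2 by rewrite divr_gt0.
have [c Cc xc] := Ex _ e2; exists (J c); first exact: CJ.
by rewrite -raddfB; apply: le_lt_trans (JL _) _; lra.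
Qed.

Lemma gauge_diff x y : E x -> E y -> Q x - Q y <= `|x - y| * `|x|.
Proof.
move=> Ex Ey; have Eyx : E (y - x) by apply: (adherentB CB).
have := Dsub Ex Eyx; rewrite [x + _]addrC subrK => h.
have := Db Ex Eyx; rewrite ler_norml distrC => /andP[h1 _]; rewrite mulrC; lra.
Qed.

Variables (x0 : Z) (e0 l : R).
Hypothesis e00 : 0 < e0.
Hypothesis l0 : 0 < l.
Hypothesis Sx0 : S x0.
Hypothesis Cx0 : C x0.
Hypothesis x0e : `|J x0 - w0| <= 2 * e0.
Hypothesis Jne : forall s, S s -> `|s - x0| <= l -> J s <> w0.

(** Up to sign, [k] is the derivative along [E] at the minimizer [w]: [D d (J _) / (2 * th)] comes
    from [theta], and [gl], the sum of the [mu j * D (w - x j)], from the perturbation. The slope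
    [16 * e0 / l] is [2 * mu 0 * l]; the [1 / 8] comes from [D d d / (2 * th) >= th / 2] and
    [|d| <= 4 * th]. As [Q] is quadratic, the square root keeps the slope away from zero for small
    [d]. *)
Lemma frechet_normal_subspace : exists w (k : dual Z),
  [/\ S w, E w, `|w - x0| <= l,
      (forall x, E x -> k x <= proj_bound (16 * e0 / l) x) /\
      (1 / 8 - 16 * e0 / l) * `|J w - w0| <= k (- (J w - w0)) &
      forall e : R, 0 < e -> exists2 d : R, 0 < d & forall s, S s -> E s ->
        `|s - w| < d -> k (s - w) <= e * `|s - w|].
Proof.
pose S' := S `&` E; pose theta s := Num.sqrt (Q (J s - w0)).
have EB := adherentB CB.
have ED := adherentD C0 CB.
have Ew0 : E w0 by exact: subset_adherent.
have Ej s : E s -> E (J s - w0) by move=> Es; apply: EB => //; exact: adherentJ.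
have Q0 x : E x -> 0 <= Q x.
  by move=> Ex; have /andP[h _] := Qb Ex; have := sqr_ge0 `|x|; lra.
have thetaE s : E s -> theta s ^+ 2 = Q (J s - w0).
  by move=> Es; rewrite sqr_sqrtr// Q0//; exact: Ej.
have [| | | | | | | |||x [w [[Sw Ew] Sx wx xx0 VP]]] :=
  @smooth_variational_principle R Z S' theta (fun x y => Q (x - y)) cZ _ _ _ _ _ _ x0 e0 l.
- move=> x Sx; split; last first.
    apply: adherent_idem => e ep; have [c [_ Ec] xc] := Sx e ep; by exists c.
  by apply: Scl => e ep; have [c [Sc _] xc] := Sx e ep; exists c.
- by move=> x _; exact: sqrtr_ge0.
- move=> x [_ Ex] e ep; pose A := `|J x - w0|.
  have A0 : 0 <= A by exact: normr_ge0.
  have A1 : 0 < 4 * (2 * A + 4) by lra.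
  exists (Num.min 1 (e ^+ 2 / (4 * (2 * A + 4)))).
    by rewrite lt_min ltr01 divr_gt0// exprn_gt0.
  move=> y [_ Ey]; rewrite lt_min => /andP[y1]; rewrite ltr_pdivlMr// => ye.
  have jE : (J y - w0) - (J x - w0) = J (y - x).
    by rewrite [RHS]raddfB opprB addrA subrK.
  have := gauge_diff (Ej _ Ex) (Ej _ Ey); have := gauge_diff (Ej _ Ey) (Ej _ Ex).
  rewrite -!thetaE// -[J x - w0 - _]opprB normrN jE -/A.
  have : `|J y - w0| <= A + 2.
    have -> : J y - w0 = (J x - w0) + J (y - x) by rewrite -jE [RHS]addrC subrK.
    by apply: le_trans (ler_normD _ _) _; have := JL (y - x); rewrite /A; lra.
  have := JL (y - x); have := normr_ge0 (J (y - x)); have := normr_ge0 (J x - w0).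
  have := normr_ge0 (y - x); rewrite -/A.
  have := sqrtr_ge0 (Q (J y - w0)); have := sqrtr_ge0 (Q (J x - w0)).
  rewrite -/(theta y) -/(theta x) => tx ty n1 n2 n3 n4 n5 q1 q2.
  (* For nonnegative [a] and [b], [(a - b) ^+ 2 <= |a ^+ 2 - b ^+ 2|], so [theta] inherits
     continuity from its square. *)
  suff : `|theta y - theta x| ^+ 2 < e ^+ 2 by rewrite ltr_sqr ?nnegrE// ltW.
  rewrite real_normK ?num_real//.
  have b1 : `|J (y - x)| * `|J y - w0| <= 2 * `|y - x| * (A + 2).
    by apply: ler_pM.
  have b2 : `|J (y - x)| * A <= 2 * `|y - x| * (A + 2).
    by apply: ler_pM => //; rewrite lerDl.
  have [h|h] := leP (theta x) (theta y).
    have : (theta y - theta x) ^+ 2 <= theta y ^+ 2 - theta x ^+ 2 by nra.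
    nra.
  have : (theta y - theta x) ^+ 2 <= theta x ^+ 2 - theta y ^+ 2 by nra.
  nra.
- move=> x; rewrite subrr; apply/eqP; rewrite eq_le.
  have /Qb : E 0 by exact: subset_adherent.
  by rewrite normr0 expr0n/= !mul0r => /andP[-> ->].
- by move=> x y [_ Ex] [_ Ey]; have /andP[h _] := Qb (EB _ _ Ex Ey); lra.
- move=> x y z [_ Ex] [_ Ey] [_ Ez].
  have := gauge_diff (EB _ _ Ex Ez) (EB _ _ Ey Ez); rewrite opprB addrA subrK => /le_trans; apply.
  by rewrite ler_wpM2l// lerDl.
- by split=> //; exact: subset_adherent.
- by [].
- by [].
- have Ex0 : E x0 by exact: subset_adherent.
  rewrite -ler_sqr ?nnegrE ?sqrtr_ge0 ?(ltW e00)// thetaE//.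
  have /andP[_ h] := Qb (Ej _ Ex0); apply: le_trans h _.
  have : `|J x0 - w0| ^+ 2 <= (2 * e0) ^+ 2 by rewrite ler_sqr ?nnegrE// mulr_ge0// ltW.
  lra.
pose mu j := 8 * e0 / l ^+ 2 / 2 ^+ j.
have VP' N s : S s -> E s -> `|s - w| <= l ->
    theta w + \sum_(j < N) mu j * Q (w - x j) <=
    theta s + \sum_(j < N) mu j * Q (s - x j) + 6 * l * mu N * `|s - w|.
  by move=> Ss Es; exact: (VP N s (conj Ss Es)).
have mu0 j : 0 < mu j by rewrite /mu !divr_gt0 ?exprn_gt0// mulr_gt0.
have muS j : mu j.+1 = mu j / 2.
  by rewrite /mu; set A := 8 * e0 / l ^+ 2; rewrite exprSr invfM mulrA.
have mutau : 2 * mu 0%N * l = 16 * e0 / l.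
  by rewrite /mu expr0; field; rewrite gt_eqF.
have wx0 : `|w - x0| <= l by rewrite -xx0.
have {xx0 VP} Exj j : E (w - x j) by apply: EB => //; exact: (Sx j).2.
pose d := J w - w0; have Ed : E d by exact: Ej.
have Jd : J d = d by rewrite /d raddfB/= JJ Jw0.
have d0 : 0 < `|d|.
  by rewrite normr_gt0 subr_eq0; apply/eqP; exact: Jne.
pose th := theta w; have thE : th ^+ 2 = Q d by exact: thetaE.
have th_ge : 0 <= th by exact: sqrtr_ge0.
have dth : `|d| <= 4 * th.
  rewrite -ler_sqr ?nnegrE ?mulr_ge0//; have /andP[h _] := Qb Ed.
  by have := sqr_ge0 `|d|; nra.
have th0 : 0 < th by lra.
pose g N y := \sum_(j < N) mu j * D (w - x j) y.
have gS N y : g N.+1 y = g N y + mu N * D (w - x N) y by rewrite /g big_ord_recr.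
have gl_bound N y : E y -> `|mu N * D (w - x N) y| <= mu N * (l * `|y|).
  move=> Ey; rewrite normrM gtr0_norm// ler_pM2l//; apply: le_trans (Db (Exj N) Ey) _.
  by rewrite ler_wpM2r.
have gcauchy N M y : E y -> (N <= M)%N -> `|g M y - g N y| <= l * `|y| * (2 * mu N - 2 * mu M).
  move=> Ey /subnK <-; elim: (M - N)%N => [|k IH]; first by rewrite !subrr normr0 mulr0.
  rewrite addSn gS muS addrAC; apply: le_trans (ler_normD _ _) _.
  by have := gl_bound (k + N)%N y Ey; lra.
have muto (e : R) : 0 < e -> exists N, forall n, (N <= n)%N -> mu n < e.
  exact: dyadic_small.
have gcauchy' N M y : E y -> (N <= M)%N -> `|g M y - g N y| <= l * `|y| * (2 * mu N).
  move=> Ey NM; apply: le_trans (gcauchy N M y Ey NM) _.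
  rewrite ler_wpM2l ?mulr_ge0 ?(ltW l0)// gerBl mulr_ge0//; exact: ltW.
have /choice[gl hgl] : forall y, exists v : R^o, E y -> converges (fun n => g n y : R^o) v.
  move=> y; have [Ey|nEy] := pselect (E y); last by exists 0.
  suff [v hv] : exists v : R^o, converges (fun n => g n y : R^o) v by exists v.
  apply: complete_seq_complete => e ep.
  have ly : 0 < 4 * (l * `|y| + 1) by rewrite mulr_gt0// ltr_wpDl// mulr_ge0// ltW.
  have [N hN] := muto _ (divr_gt0 ep ly); have {}hN := hN N (leqnn N).
  rewrite ltr_pdivlMr// in hN.
  exists N => m n Nm Nn.
  have h1 := gcauchy' N m y Ey Nm; have h2 := gcauchy' N n y Ey Nn.
  have := ler_distD (g N y) (g m y) (g n y); rewrite (distrC (g N y)).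
  have := mu0 N; lra.
have glN N y : E y -> `|gl y - g N y| <= l * `|y| * (2 * mu N).
  move=> Ey; apply/ler_addgt0Pr => e ep; have [M hM] := hgl y Ey e ep.
  have := hM _ (leq_maxl M N); have := gcauchy' N _ y Ey (leq_maxr M N).
  have := ler_distD (g (maxn M N) y) (gl y) (g N y); rewrite (distrC (gl y) (g (maxn M N) y)).
  by move=> *; lra.
have gltau y : E y -> `|gl y| <= 16 * e0 / l * `|y|.
  move=> Ey; have := glN 0%N y Ey; rewrite /g big_ord0 subr0 -mutau => h.
  by apply: le_trans h _; rewrite mulrC mulrA.
have gB N y z : g N (y - z) = g N y - g N z.
  by rewrite /g -sumrB; apply: eq_bigr => j _; rewrite raddfB/= mulrBr.
have glB y z : E y -> E z -> gl (y - z) = gl y - gl z.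
  move=> Ey Ez; apply/eqP; rewrite -subr_eq0 -normr_le0; apply/ler_addgt0Pr => e ep.
  have K0 : 0 < 2 * l * (`|y - z| + `|y| + `|z|) + 1.
    by rewrite ltr_wpDl// mulr_ge0 ?addr_ge0// mulr_ge0// ltW.
  have [N hN] := muto _ (divr_gt0 ep K0); have {}hN := hN N (leqnn N).
  rewrite ltr_pdivlMr// in hN.
  have := glN N _ (EB _ _ Ey Ez); have := glN N _ Ey; have := glN N _ Ez.
  rewrite gB add0r !ler_norml; have := mu0 N => m0 /andP[? ?] /andP[? ?] /andP[? ?].
  by apply/andP; split; lra.
pose kk y : R := - (D d (J y) / (2 * th) + gl y).
have th2 : 0 < 2 * th by lra.
have Dd y : E y -> `|D d (J y) / (2 * th)| <= 2 * `|J y|.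
  move=> Ey; rewrite normrM normfV (gtr0_norm th2) ler_pdivrMr//.
  apply: le_trans (Db Ed (adherentJ Ey)) _.
  have := ler_wpM2r (normr_ge0 (J y)) dth; lra.
have kkp y : E y -> kk y <= proj_bound (16 * e0 / l) y.
  move=> Ey; rewrite /kk /proj_bound; have := Dd y Ey; have := gltau y Ey.
  by rewrite !ler_norml => /andP[? ?] /andP[? ?]; lra.
have tau0 : 0 < 16 * e0 / l by rewrite divr_gt0// mulr_gt0.
have [|||||k [kE _]] := @dual_extend _ _ E kk (4 + 16 * e0 / l).
- by lra.
- exact: subset_adherent.
- exact: EB.
- by move=> y z Ey Ez; rewrite /kk glB// raddfB/= raddfB/=; ring.
- by move=> y Ey; apply: le_trans (kkp y Ey) (proj_bound_le _ _).
exists w, k; split=> //.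
  split; first by move=> y Ey; rewrite kE//; exact: kkp.
  rewrite -/d raddfN/= kE// /kk opprK Jd.
  have h1 := QD Ed; have := gltau d Ed; rewrite ler_norml => /andP[h2 _].
  have h3 : th / 2 <= D d d / (2 * th).
    rewrite ler_pdivlMr//; apply: le_trans h1; rewrite -thE; lra.
  lra.
have upper N : forall e : R, 0 < e -> exists2 t : R, 0 < t & forall y, E y -> `|y| < t ->
    \sum_(j < N) mu j * Q (w + y - x j) <=
    \sum_(j < N) mu j * Q (w - x j) + g N y + e * `|y|.
  elim: N => [|N IH] e ep.
    by exists 1 => // y _ _; rewrite /g !big_ord0 !add0r mulr_ge0// ltW.
  have e2 : 0 < e / 2 by rewrite divr_gt0.
  have [t1 t10 h1] := IH _ e2; have [t2 t20 h2] := Dfre (Exj N) (divr_gt0 e2 (mu0 N)).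
  exists (Num.min t1 t2); first by rewrite lt_min t10.
  move=> y Ey; rewrite lt_min => /andP[y1 y2]; rewrite !big_ord_recr/= gS.
  have := h1 y Ey y1; have := ler_wpM2l (ltW (mu0 N)) (h2 y Ey y2).
  rewrite mulrDr mulrA [mu N * (_ / _)]mulrC divfK ?gt_eqF// addrAC; lra.
move=> e ep.
have e8 : 0 < e / 8 by rewrite divr_gt0.
have l6 : 0 < 6 * l by rewrite mulr_gt0.
(* [N] is fixed before the radius: beyond it the perturbation has slope at most
   [6 * l * mu N < e / 8], so only finitely many Frechet estimates have to hold together. *)
have [N hN] := muto _ (divr_gt0 e8 l6); have {}hN := hN N (leqnn N).
rewrite ltr_pdivlMr// in hN.
have [t1 t10 h1] := upper N _ e8.
have eth : 0 < e / 4 * th by rewrite mulr_gt0// divr_gt0.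
have [t2 t20 h2] := Dfre Ed eth.
exists (Num.min l (Num.min t1 (t2 / 2))); first by rewrite !lt_min l0 t10 divr_gt0.
move=> s Ss Es; rewrite !lt_min => /and3P[sl s1 s2].
pose y := s - w; have Ey : E y by exact: EB.
have sE : s = w + y by rewrite /y [RHS]addrC subrK.
have := VP' N s Ss Es (ltW sl).
have := h1 y Ey s1; rewrite -/y -sE.
have Jy : `|J y| < t2 by have := JL y; rewrite -/y in s2; lra.
have := h2 _ (adherentJ Ey) Jy.
have -> : d + J y = J s - w0.
  have -> : J s = J w + J y by rewrite {1}sE raddfD.
  by rewrite /d addrAC.
rewrite -thetaE// -thE kE// /kk => a1 a2 a3.
have a4 := glN N y Ey; rewrite ler_norml in a4; have /andP[a5 a6] := a4.
have a7 : theta s - th <= (D d (J y) + e / 4 * th * `|J y|) / (2 * th).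
  by rewrite ler_pdivlMr//; have := sqr_ge0 (theta s - th); nra.
have a8 : (D d (J y) + e / 4 * th * `|J y|) / (2 * th) = D d (J y) / (2 * th) + e / 8 * `|J y|.
  by field; rewrite gt_eqF.
have a9 : e / 8 * `|J y| <= e / 4 * `|y|.
  by have := ler_wpM2l (ltW e8) (JL y); lra.
have b1 : mu N * (6 * l) * `|y| <= e / 8 * `|y| by rewrite ler_wpM2r// ltW.
have b2 : 0 <= e * `|y| by rewrite mulr_ge0// ltW.
have b3 : 0 <= mu N * l * `|y| by rewrite mulr_ge0// ltW// mulr_gt0.
rewrite a8 in a7; rewrite -/th in a3; lra.
Qed.

End Frechet.

Lemma frechet_normal_near (S : set Z) (x0 : Z) (e0 l tau : R) :
  @seq_complete R Z -> dual_separable Z -> (forall x, adherent S x -> S x) ->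
  0 < e0 -> 0 < l -> S x0 -> `|J x0 - w0| <= e0 ->
  (forall s, S s -> `|s - x0| <= l -> J s <> w0) ->
  48 * e0 / l <= tau -> tau <= 1 / 32 ->
  exists w (f : dual Z) (H : Z),
    [/\ S w /\ `|w - x0| <= l, forall x, f x <= proj_bound tau x,
        H != 0, `|H| / 16 <= f H &
        forall e : R, 0 < e -> exists2 d : R, 0 < d & forall s, S s ->
          `|s - w| < d -> f (s - w) <= e * `|s - w|].
Proof.
move=> cZ dZ Scl e00 l0 Sx0 x0e Jne etau tau1.
have el0 : 0 < e0 / l by rewrite divr_gt0.
have etau' : 16 * e0 / l <= tau by lra.
have tau0 : 0 < tau by lra.
pose p := proj_bound tau; have hp : sublinear p by apply: proj_bound_sublinear; exact: ltW.
have pL x : p x <= (4 + tau) * `|x| by exact: proj_bound_le.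
(* The number [n] codes the numerical data of a certificate. [wit] returns the points of a chosen
   certificate with these data, or nothing if there is none; countably many requests thus suffice
   for [C]. *)
pose wit n x H := if @unpickle (nat * nat * seq (nat * nat))%type n is Some (m, r, ps)
  then map snd (xget [::] [set t | map fst t = ps /\
    violation S p 16^-1 x H ((2 ^+ r)^-1) m t]) else [::].
have [c [c0c cC]] := countable_closure
  (fun n x y => [:: x - y, 2^-1 *: x, J x & wit n x y])
  (fun n => if n == 0%N then w0 else x0).
pose C : set Z := range c.
have Cw0 : C w0 by apply: c0c; exists 0%N.
have Cx0 : C x0 by apply: c0c; exists 1%N.
have CB x y : C x -> C y -> C (x - y).
  by move=> Cx Cy; apply: (cC 0%N _ _ _ Cx Cy); rewrite !inE eqxx.
have CH x : C x -> C (2^-1 *: x).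
  by move=> Cx; apply: (cC 0%N _ _ _ Cx Cx); rewrite !inE eqxx orbT.
have CJ x : C x -> C (J x).
  by move=> Cx; apply: (cC 0%N _ _ _ Cx Cx); rewrite !inE eqxx !orbT.
have C0 : C 0 by have := CB _ _ Cw0 Cw0; rewrite subrr.
have CV x H r m t : C x -> C H -> violation S p 16^-1 x H ((2 ^+ r)^-1) m t ->
    exists t', [/\ map fst t' = map fst t, violation S p 16^-1 x H ((2 ^+ r)^-1) m t' &
      forall s, s \in t' -> C s.2].
  move=> Cx CHH V.
  set P := [set t' | map fst t' = map fst t /\
    violation S p 16^-1 x H ((2 ^+ r)^-1) m t'].
  have [t1 t2] : P (xget [::] P) by case: xgetP => [? _ //|/(_ t) []].
  exists (xget [::] P); split=> // s st.
  apply: (cC (pickle (m, r, map fst t)) _ _ _ Cx CHH).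
  by rewrite /wit pickleK !inE map_f ?orbT.
have [Q [D [Qb Db QD Dsub Dfre]]] := smooth_gauge_separable dZ (erefl C) C0 CB CH.
have x0e' : `|J x0 - w0| <= 2 * e0 by lra.
have [w [k [Sw Ew wx0 [kp kd] kn]]] := frechet_normal_subspace cZ Scl C0 CB CJ Cw0
  Qb Db QD Dsub Dfre e00 l0 Sx0 Cx0 x0e' Jne.
pose d := J w - w0; have d0 : 0 < `|d|.
  by rewrite normr_gt0 subr_eq0; apply/eqP; exact: Jne.
have kp' x : adherent C x -> k x <= p x.
  move=> Ex; apply: le_trans (kp x Ex) _.
  by rewrite /p /proj_bound lerD2l ler_wpM2r.
have Ed : adherent C (- d).
  rewrite -sub0r; apply: (adherentB CB); first exact: subset_adherent.
  apply: (adherentB CB); last exact: subset_adherent.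
  exact: adherentJ.
(* Certificates are available only for directions in [C], so [- d] is approximated by [H]; the
   surplus of [1 / 8 - 1 / 32] over [1 / 16] absorbs the error. *)
have d200 : 0 < `|d| / 200 by rewrite divr_gt0.
have [H CHH dH] := Ed _ d200.
have H1 : `|H| <= `|d| + `|- d - H|.
  by have := ler_distD (- d) H 0; rewrite !subr0 normrN (distrC H) addrC.
have H2 : `|d| <= `|H| + `|- d - H|.
  by have := ler_distD H (- d) 0; rewrite !subr0 normrN addrC.
have kH : 16^-1 * `|H| <= k H.
  have : k (- d - H) <= (4 + tau) * `|- d - H|.
    by apply: le_trans (kp' _ _) (pL _); apply: (adherentB CB) => //; exact: subset_adherent.
  rewrite raddfB/=.
  have := ler_wpM2r (normr_ge0 (- d - H)) tau1.
  have : (1 / 8 - tau) * `|d| <= (1 / 8 - 16 * e0 / l) * `|d|.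
    by rewrite ler_wpM2r// lerD2l lerN2.
  have : tau * `|d| <= `|d| / 32 by have := ler_wpM2r (ltW d0) tau1; lra.
  move: kd; rewrite -/d; lra.
have kn' n : exists m, forall s, S s -> adherent C s -> `|s - w| < (2 ^+ m)^-1 ->
    k (s - w) <= (2 ^+ n)^-1 * `|s - w|.
  have [|t t0 ht] := kn (2 ^+ n)^-1; first by rewrite invr_gt0 exprn_gt0.
  have [m hm] := dyadic_small 1 t0; exists m => s Ss Es sw; apply: ht => //.
  by apply: lt_trans sw _; have := hm m (leqnn m); rewrite mul1r.
have tau4 : 0 < 4 + tau by lra.
have [f [fp fH fn]] := frechet_normal_lift hp tau4 pL C0 CB CV Ew CHH kH kp' kn'.
exists w, f, H; split=> //.
- rewrite -normr_gt0; lra.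
- by rewrite mulrC.
- move=> e ep; have [n hn] := dyadic_small 1 ep; have [m hm] := fn n.
  exists (2 ^+ m)^-1; first by rewrite invr_gt0 exprn_gt0.
  move=> s Ss sw; apply: le_trans (hm s Ss sw) _; rewrite ler_wpM2r//.
  by have := hn n (leqnn n); rewrite mul1r => /ltW.
Qed.

(** * The Clarke case *)

Lemma clarke_tangent0 (S : set Z) w : clarke_tangent S w 0.
Proof.
move=> z t Sz _ _ _; exists (fun=> 0); first exact: cvg_cst.
by move=> k; rewrite scaler0 addr0.
Qed.

(** The points [z k + t k *: v k] lie in [S] and still converge to [w], so the second vector is
    followed from them: the moving base point in the definition makes the cone convex. *)
Lemma clarke_tangentD (S : set Z) w x y :
  clarke_tangent S w x -> clarke_tangent S w y -> clarke_tangent S w (x + y).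
Proof.
move=> Tx Ty z t Sz zw t0 tc; have [v vx Sv] := Tx z t Sz zw t0 tc.
have zc : (fun k => z k + t k *: v k) @ \oo --> w.
  rewrite -[w]addr0 -[0](scale0r x); apply: cvgD => //; exact: cvgZ.
have [u uy Su] := Ty _ t Sv zc t0 tc.
exists (fun k => v k + u k); first exact: cvgD.
by move=> k; rewrite scalerDr addrA.
Qed.

(** The norm itself serves in [theta], and the case [N = 0] of the variational principle, with [rho]
    the squared distance, suffices; its slope is [6 * l * (8 * e0 / l ^+ 2) = 48 * e0 / l]. *)
Lemma clarke_normal_near (S : set Z) (x0 : Z) (e0 l tau : R) :
  @seq_complete R Z -> (forall x, adherent S x -> S x) ->
  0 < e0 -> 0 < l -> S x0 -> `|J x0 - w0| <= e0 ->
  (forall s, S s -> `|s - x0| <= l -> J s <> w0) ->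
  48 * e0 / l <= tau -> tau <= 1 / 32 ->
  exists w (f : dual Z) (H : Z),
    [/\ S w /\ `|w - x0| <= l, forall x, f x <= proj_bound tau x,
        H != 0, `|H| / 16 <= f H & clarke_normal S w f].
Proof.
move=> cZ Scl e00 l0 Sx0 x0e Jne etau tau1.
have el0 : 0 < e0 / l by rewrite divr_gt0.
have tau0 : 0 < tau by lra.
have hp : sublinear (proj_bound tau) by apply: proj_bound_sublinear; exact: ltW.
have dd s x : `|J s - w0| <= `|J x - w0| + 2 * `|s - x|.
  have := ler_distD (J x) (J s) w0; have := JL (s - x); rewrite raddfB/=; lra.
have [| | | | | | | | |x [w [Sw Sx wx xx0 VP]]] :=
  @smooth_variational_principle R Z S (fun s => `|J s - w0|)
    (fun x y => `|x - y| ^+ 2) cZ Scl _ _ _ _ _ x0 e0 l => //.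
- move=> x Sx e ep; exists (e / 4); first by rewrite divr_gt0.
  move=> y Sy yx; have := dd y x; have := dd x y; rewrite (distrC x y) => h1 h2.
  by rewrite ltr_norml; apply/andP; split; lra.
- by move=> x; rewrite subrr normr0 expr0n.
- by move=> x y _ _; have := sqr_ge0 `|x - y|; lra.
- move=> x y z _ _ _; have := ler_distD y x z.
  have := normr_ge0 (x - z); have := normr_ge0 (y - z); nra.
have {}VP s : S s -> `|s - w| <= l -> `|J w - w0| <= `|J s - w0| + tau * `|s - w|.
  move=> Ss sl; have := VP 0%N s Ss sl; rewrite !big_ord0 !addr0 => /le_trans; apply.
  rewrite lerD2l ler_wpM2r//; apply: le_trans etau.
  have -> // : 6 * l * (8 * e0 / l ^+ 2 / 2 ^+ 0) = 48 * e0 / l.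
  by rewrite expr0; field; rewrite gt_eqF.
have wx0 : `|w - x0| <= l by rewrite -xx0.
pose d := J w - w0; have Jd : J d = d by rewrite /d raddfB/= JJ Jw0.
have d0 : 0 < `|d|.
  by rewrite normr_gt0 subr_eq0; apply/eqP; exact: Jne.
(* Compare [w] with [w + t *: v k], where [v k] tends to [y]. Writing [J (w + t *: v k) - w0] as [(1
   - t * mu) *: d + t *: (J (v k) + mu *: d)] cancels [d] up to [t * mu], and one divides by [t]. *)
have slope y (mu : R) : clarke_tangent S w y -> 0 <= mu ->
    mu * `|d| <= `|J y + mu *: d| + tau * `|y|.
  move=> Ty mu0.
  have [//||||v vy Sv] := Ty (fun=> w) (fun k => k.+1%:R^-1).
  - exact: cvg_cst.
  - by move=> k; rewrite invr_gt0.
  - exact: cvg_harmonic.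
  apply/ler_addgt0Pr => e ep.
  have e4 : 0 < e / 4 by rewrite divr_gt0.
  have [N _ hN] : \forall k \near \oo, `|y - v k| < e / 4 by move/cvgrPdist_lt : vy; exact.
  have [n hn] := ltr_natP (mu + (`|y| + e) / l).
  pose k := maxn N n; have {hN} yv := hN k (leq_maxl _ _).
  pose t : R := k.+1%:R^-1; have t0 : 0 < t by rewrite invr_gt0.
  have kn : mu + (`|y| + e) / l < k.+1%:R.
    by apply: lt_le_trans hn _; rewrite ler_nat ltnS leq_maxr.
  have tmu : t * mu <= 1.
    rewrite mulrC ler_pdivrMr// mul1r; have : 0 <= (`|y| + e) / l.
      by rewrite divr_ge0 ?addr_ge0// ltW.
    lra.
  have vk : `|v k| <= `|y| + e / 4.
    by have := ler_distD y (v k) 0; rewrite !subr0 distrC addrC; lra.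
  have tv : t * `|v k| <= l.
    rewrite mulrC ler_pdivrMr// mulrC -ler_pdivrMr//; apply: ltW; apply: le_lt_trans kn.
    apply: le_trans (_ : (`|y| + e) / l <= _); last by rewrite lerDr.
    by rewrite ler_pM2r ?invr_gt0//; lra.
  have := VP _ (Sv k); rewrite -/t addrC addKr normrZ gtr0_norm// => /(_ tv).
  have -> : J (w + t *: v k) - w0 = (1 - t * mu) *: d + t *: (J (v k) + mu *: d).
    have -> : t *: (J (v k) + mu *: d) = t *: J (v k) + (t * mu) *: d.
      by rewrite scalerDr scalerA.
    have -> : J (w + t *: v k) = J w + t *: J (v k) by rewrite raddfD/= linearZ.
    rewrite scalerBl scale1r.
    by rewrite [t *: J (v k) + _]addrC addrA subrK /d addrAC.
  rewrite -/d => h.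
  have h1 : `|(1 - t * mu) *: d + t *: (J (v k) + mu *: d)| <=
      (1 - t * mu) * `|d| + t * `|J (v k) + mu *: d|.
    apply: le_trans (ler_normD _ _) _; rewrite !normrZ !ger0_norm ?(ltW t0)//; lra.
  have h2 : t * (mu * `|d|) <= t * (`|J (v k) + mu *: d| + tau * `|v k|) by lra.
  rewrite ler_pM2l// in h2.
  have h3 : `|J (v k) + mu *: d| <= `|J y + mu *: d| + e / 2.
    have -> : J (v k) + mu *: d = (J y + mu *: d) + J (v k - y).
      rewrite [J (v k - y)]raddfB [LHS]addrC [J y + _]addrC -addrA; congr (_ + _).
      by rewrite [RHS]addrC subrK.
    apply: le_trans (ler_normD _ _) _; rewrite lerD2l.
    by have := JL (v k - y); rewrite (distrC (v k)); lra.
  have h4 : tau * `|v k| <= tau * `|y| + e / 4.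
    apply: le_trans (ler_wpM2l (ltW tau0) vk) _; rewrite mulrDr lerD2l.
    by rewrite ler_piMl// ?ltW//; lra.
  lra.
(* Two demands on [g] in one semigroup: nonnegative on the tangent cone, and at least [|d| / 16] at
   [d]. Then [- g] is normal and [- d] serves as [H]. *)
pose T := [set v : Z * R | exists y (mu : R), [/\ clarke_tangent S w y, 0 <= mu &
  v = (y + mu *: d, mu * (`|d| / 16))]].
have [|||g [gp gT]] := mazur_orlicz (T := T) hp (proj_bound_le tau).
- exists 0, 0; split=> //; first exact: clarke_tangent0.
  by rewrite scale0r mul0r addr0.
- move=> _ _ [y [m [Ty m0 ->]]] [z [n [Tz n0 ->]]]; exists (y + z), (m + n).
  split; [exact: clarke_tangentD|exact: addr_ge0|].
  by rewrite scalerDl mulrDl -[RHS]/(_, _) addrACA.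
- move=> _ [y [m [Ty m0 ->]]] /=; have := slope y m Ty m0.
  rewrite /proj_bound.
  have -> : J (y + m *: d) = J y + m *: d by rewrite [LHS]raddfD/= linearZ/= Jd.
  have : `|y| <= `|y + m *: d| + m * `|d|.
    have := ler_normB (y + m *: d) (m *: d); rewrite addrK normrZ ger0_norm//.
  move=> /(ler_wpM2l (ltW tau0)); have := normr_ge0 (J y + m *: d).
  have : 0 <= m * `|d| by rewrite mulr_ge0.
  have : tau * (m * `|d|) <= 1 / 32 * (m * `|d|) by rewrite ler_wpM2r// mulr_ge0.
  lra.
have gN y : dual_comb (-1) 0 g g y = g (- y).
  by rewrite dual_combE mul0r addr0 mulN1r raddfN.
exists w, (dual_comb (-1) 0 g g), (- d); split=> //.
- by move=> y; rewrite gN; apply: le_trans (gp _) _; rewrite proj_boundN.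
- by rewrite oppr_eq0 -normr_gt0.
- rewrite gN opprK normrN; apply: (gT (d, `|d| / 16)).
  exists 0, 1; split=> //; first exact: clarke_tangent0.
  by rewrite scale1r mul1r add0r.
- split=> // y Ty; rewrite gN raddfN/= oppr_le0; apply: (gT (y, 0)).
  by exists y, 0; split=> //; rewrite scale0r mul0r addr0.
Qed.

End Projection.

(** * Approximate stationarity *)

Lemma adherent_prod {R : realType} {X Y : normedModType R} (A : set X) (B : set Y) z :
  adherent (A `*` B) z -> adherent A z.1 /\ adherent B z.2.
Proof.
move=> ABz; split=> e e0; have [c [Ac Bc] zc] := ABz e e0.
- by exists c.1 => //; exact: le_lt_trans (prod_norm_fst (z - c)) zc.
- by exists c.2 => //; exact: le_lt_trans (prod_norm_snd (z - c)) zc.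
Qed.

Section DifferenceProjection.
Context {R : realType} {Z : normedModType R}.

Definition diff_proj (z : Z * Z) : Z * Z := (z.1 - z.2, 0).

Lemma diff_proj_linear : linear diff_proj.
Proof.
move=> a x y; apply/pair_equal_spec; split => /=; last by rewrite scaler0 addr0.
by rewrite scalerBr opprD addrACA.
Qed.

HB.instance Definition _ :=
  GRing.isLinear.Build R (Z * Z)%type (Z * Z)%type *:%R diff_proj diff_proj_linear.

Lemma diff_proj_idem z : diff_proj (diff_proj z) = diff_proj z.
Proof. by rewrite /diff_proj /= subr0. Qed.

Lemma diff_proj_bound z : `|diff_proj z| <= 2 * `|z|.
Proof.
rewrite prod_normE/= normr0 ge_max mulr_ge0// andbT.
apply: le_trans (ler_normB _ _) _; rewrite mulr_natl mulr2n.
by apply: lerD; [exact: prod_norm_fst|exact: prod_norm_snd].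
Qed.

End DifferenceProjection.

Section DualNorm.
Context {R : realType}.
Implicit Types Z : normedModType R.

Lemma dual_norm_bound Z (f : dual Z) x : `|f x| <= dual_norm f * `|x|.
Proof.
have [->|x0] := eqVneq x 0; first by rewrite raddf0 !normr0 mulr0.
have x0' : 0 < `|x| by rewrite normr_gt0.
have := @dual_norm_ub R Z f (`|x|^-1 *: x).
rewrite dualZ normrM normrZ !normfV !normr_id mulVf ?gt_eqF// => /(_ (lexx _)).
by rewrite mulrC ler_pdivrMr.
Qed.

Lemma dual_norm_le Z (f : dual Z) M : 0 <= M ->
  (forall x, `|f x| <= M * `|x|) -> dual_norm f <= M.
Proof.
move=> M0 fM; apply: ge_sup (dual_has_sup f).1 _ => _ [x [_ /= x1] <-].
by apply: le_trans (fM x) _; rewrite ler_piMr.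
Qed.

Lemma dual_norm_ge0 Z (f : dual Z) : 0 <= dual_norm f.
Proof. by apply: le_trans (dual_norm_ub f (_ : `|0| <= 1)); rewrite ?normr0. Qed.

Lemma dual_norm_scale Z (a : R) (f h : dual Z) : 0 < a ->
  (forall x, h x = a * f x) -> dual_norm h = a * dual_norm f.
Proof.
move=> a0 hf; apply/eqP; rewrite eq_le; apply/andP; split.
  apply: dual_norm_le => [|x]; first by rewrite mulr_ge0 ?dual_norm_ge0// ltW.
  by rewrite hf normrM gtr0_norm// -mulrA ler_pM2l// dual_norm_bound.
rewrite -ler_pdivlMl//; apply: dual_norm_le => [|x].
  by rewrite mulr_ge0 ?dual_norm_ge0// invr_ge0 ltW.
rewrite -mulrA ler_pdivlMl//; have := dual_norm_bound h x.
by rewrite hf normrM gtr0_norm.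
Qed.

End DualNorm.

(** On the diagonal [diff_proj] vanishes, so [f (v, v) <= tau * |v|] bounds the sum of the two
    components. The bound at [H] forces their total norm [n] to be at least [1 / 16], so dividing by
    [n] costs a factor of at most 16. *)
Lemma normalized_components {R : realType} {X Y : normedModType R}
    (f : dual ((X * Y) * (X * Y))%type) (H : ((X * Y) * (X * Y))%type) (tau : R) :
  0 <= tau -> (forall x, f x <= proj_bound diff_proj tau x) ->
  H != 0 -> `|H| / 16 <= f H ->
  exists (a : R) (f1 : dual X) (g1 : dual Y) (f2 : dual X) (g2 : dual Y),
    [/\ 0 < a, forall u, dual_pair f1 g1 u = a * dual_inl f u,
        (forall x, f2 x = a * dual_inl (dual_inr f) x) /\
        (forall y, g2 y = a * dual_inr (dual_inr f) y),
        pair_norm (f1 \+ f2) (g1 \+ g2) <= 16 * tau &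
        pair_norm f1 g1 + pair_norm f2 g2 = 1].
Proof.
move=> tau0 fp H0 fH.
pose F1 := dual_inl f; pose F2 := dual_inr f.
pose f1 := dual_inl F1; pose g1 := dual_inr F1.
pose f2 := dual_inl F2; pose g2 := dual_inr F2.
have fE u : f u = f1 u.1.1 + g1 u.1.2 + (f2 u.2.1 + g2 u.2.2).
  have -> : f1 u.1.1 + g1 u.1.2 = F1 u.1 by exact: esym (dual_prodE _ _).
  have -> : f2 u.2.1 + g2 u.2.2 = F2 u.2 by exact: esym (dual_prodE _ _).
  exact: dual_prodE.
pose n := pair_norm f1 g1 + pair_norm f2 g2.
have n16 : 1 <= 16 * n.
  have H0' : 0 < `|H| by rewrite normr_gt0.
  have fHn : f H <= n * `|H|.
    have bd (Z : normedModType R) (g : dual Z) z : `|z| <= `|H| ->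
        g z <= dual_norm g * `|H|.
      move=> zH; apply: le_trans (ler_norm _) _; apply: le_trans (dual_norm_bound _ _) _.
      by rewrite ler_wpM2l// dual_norm_ge0.
    rewrite fE /n /pair_norm !mulrDl; apply: lerD; apply: lerD; apply: bd.
    - exact: le_trans (prod_norm_fst H.1) (prod_norm_fst H).
    - exact: le_trans (prod_norm_snd H.1) (prod_norm_fst H).
    - exact: le_trans (prod_norm_fst H.2) (prod_norm_snd H).
    - exact: le_trans (prod_norm_snd H.2) (prod_norm_snd H).
  rewrite -(ler_pM2r H0') mul1r -mulrA -ler_pdivrMl// mulrC.
  exact: le_trans fH fHn.
have n0 : 0 < n.
  by rewrite -(pmulr_rgt0 _ (ltr0n R 16)) (lt_le_trans ltr01).
have ni : 0 < n^-1 by rewrite invr_gt0.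
pose sc (Z : normedModType R) (g : dual Z) := dual_comb n^-1 0 g g.
have scE (Z : normedModType R) (g : dual Z) x : sc Z g x = n^-1 * g x.
  by rewrite dual_combE mul0r addr0.
have scn (Z : normedModType R) (g : dual Z) : dual_norm (sc Z g) = n^-1 * dual_norm g.
  by apply: dual_norm_scale ni _ => v; exact: scE.
exists n^-1, (sc X f1), (sc Y g1), (sc X f2), (sc Y g2); split => //.
- move=> u; have -> : dual_inl f u = f1 u.1 + g1 u.2 by exact: dual_prodE.
  have -> : dual_pair (sc X f1) (sc Y g1) u = sc X f1 u.1 + sc Y g1 u.2 by [].
  by rewrite !scE mulrDr.
- have -> : sc X f1 \+ sc X f2 = dual_comb 1 1 (sc X f1) (sc X f2).
    by apply/funext => u; rewrite dual_combE !mul1r.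
  have -> : sc Y g1 \+ sc Y g2 = dual_comb 1 1 (sc Y g1) (sc Y g2).
    by apply/funext => u; rewrite dual_combE !mul1r.
  rewrite -dual_norm_dual_pair; apply: (@le_trans _ _ (n^-1 * tau)); last first.
    by rewrite ler_pdivrMl// mulrA [n * 16]mulrC ler_peMl.
  apply: dual_norm_le => [|u]; first by rewrite mulr_ge0// ltW.
  set P := dual_pair _ _.
  have PE v : P v = n^-1 * f (v, v).
    have -> : P v = dual_comb 1 1 (sc X f1) (sc X f2) v.1 +
      dual_comb 1 1 (sc Y g1) (sc Y g2) v.2 by [].
    by rewrite fE !(dual_combE 1 1) !scE !mul1r -!mulrDr addrACA.
  have Pb v : P v <= n^-1 * tau * `|v|.
    rewrite PE -mulrA ler_pM2l//; apply: le_trans (fp _) _.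
    have D0 : diff_proj (v, v) = 0.
      by apply/pair_equal_spec; split; [exact: subrr|].
    have vv : `|(v, v)| = `|v| by rewrite prod_normE; exact: maxxx.
    by rewrite /proj_bound [X in `|X|]D0 normr0 mulr0 add0r vv.
  by rewrite ler_norml Pb andbT lerNl -raddfN; apply: le_trans (Pb _) _; rewrite normrN.
- by rewrite /pair_norm !scn -!mulrDr mulVf// gt_eqF.
Qed.

Lemma set_dist_lt {R : realType} {Z : normedModType R} (z : Z) (A : set Z) (e : R) :
  (set_dist z A < e%:E)%E -> exists2 a, A a & `|a - z| < e.
Proof.
by move=> /ereal_inf_lt[_ [a Aa <-]]; rewrite lte_fin => h; exists a.
Qed.

(* [N] is a normal cone for which closed sets admit suitable normals near points
   where the distance to [w0] along the projection is almost minimal. *)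
Lemma stationary_normals {R : realType}
    (N : forall Z : normedModType R, set Z -> Z -> set (dual Z))
    (X Y : normedModType R) (W := ((X * Y) * (X * Y))%type)
    (Omega : set X) (F : X -> set Y) (xb : X) (yb : Y) (Xi : set (set Y)) (e : R) :
  (forall (X Y : normedModType R) (S : set X) (T : set Y) a b f,
    N _ (S `*` T) (a, b) f -> N _ S a (dual_inl f) /\ N _ T b (dual_inr f)) ->
  (forall (Z : normedModType R) (S : set Z) z (a : R) (f h : dual Z),
    0 < a -> (forall x, h x = a * f x) -> N _ S z f -> N _ S z h) ->
  (forall (S : set W) (x0 w0 : W) (e0 l tau : R),
    diff_proj w0 = w0 -> (forall x, adherent S x -> S x) ->
    0 < e0 -> 0 < l -> S x0 -> `|diff_proj x0 - w0| <= e0 ->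
    (forall s, S s -> `|s - x0| <= l -> diff_proj s <> w0) ->
    48 * e0 / l <= tau -> tau <= 1 / 32 ->
    exists w (f : dual W) (H : W),
      [/\ S w /\ `|w - x0| <= l, forall x, f x <= proj_bound diff_proj tau x,
          H != 0, `|H| / 16 <= f H & N _ S w f]) ->
  closed Omega -> closed (gph F) -> (forall A, Xi A -> closed A) ->
  triple_approx_stationary F Omega Xi xb yb -> 0 < e ->
  exists (x1 : X) (y1 : Y) (x2 : X) (A : set Y) (y2 : Y)
         (f1 : dual X) (g1 : dual Y) (f2 : dual X) (g2 : dual Y),
    [/\ gph F (x1, y1) /\ ball (xb, yb) e (x1, y1),
        Omega x2 /\ ball xb e x2,
        Xi A,
        A y2 /\ ball yb e y2 &
        [/\ N _ (gph F) (x1, y1) (dual_pair f1 g1),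
            N _ Omega x2 f2,
            N _ A y2 g2,
            pair_norm (f1 \+ f2) (g1 \+ g2) < e &
            pair_norm f1 g1 + pair_norm f2 g2 = 1]].
Proof.
move=> Nprod Nscale Nnear cO cF cA stat e0.
pose tau : R := Num.min (1 / 32) (e / 32).
have tau1 : tau <= 1 / 32 by rewrite ge_min lexx.
have taue : tau <= e / 32 by rewrite ge_min lexx orbT.
have tau0 : 0 < tau by rewrite lt_min !divr_gt0.
(* With almost minimal value [2 * (e' * rho)] and radius [rho / 2], the required slope [48 * e0 / l]
   is [192 * e']. The bound [e / 3] keeps the points found within [e] of [(xb, yb)]. *)
pose e' := Num.min (e / 3) (tau / 192).
have e'0 : 0 < e' by rewrite lt_min !divr_gt0.
have e'e : e' <= e / 3 by rewrite ge_min lexx.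
have e't : e' <= tau / 192 by rewrite ge_min lexx orbT.
have [rho [B [z [/andP[rho0 rhoe] XiB zball dB inter]]]] := stat e' e'0.
have dlt i : (set_dist (z i) (B i) < (e' * rho)%:E)%E.
  apply: le_lt_trans dB; by rewrite (bigD1 i)//= le_max lexx.
pose i0 : 'I_2 := ord0; pose i1 : 'I_2 := ord_max.
have B0 : B i0 = gph F by have := XiB i0; rewrite /= => ->.
have [A XiA B1] : exists2 A, Xi A & B i1 = Omega `*` A.
  by have := XiB i1; rewrite /= => -[A XiA <-]; exists A.
have [a Ba az] := set_dist_lt (dlt i0); have [b Bb bz] := set_dist_lt (dlt i1).
rewrite B0 in Ba; rewrite B1 in Bb.
pose S : set W := gph F `*` (Omega `*` A).
pose w0 : W := (z i0 - z i1, 0).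
have clS x : adherent S x -> S x.
  move=> /adherent_prod[/(closed_adherent cF) Fx /adherent_prod[]].
  by move=> /(closed_adherent cO) Ox /(closed_adherent (cA _ XiA)) Ax.
have erho0 : 0 < 2 * (e' * rho) by rewrite mulr_gt0// mulr_gt0.
have rho2 : 0 < rho / 2 by rewrite divr_gt0.
have e'1 : e' <= 1 / 6144 by clear -e't tau1; lra.
have erho : e' * rho <= rho / 6144 by have := ler_wpM2r (ltW rho0) e'1; clear; lra.
have [||||||w [f [H [[Sw wx] fp H0 fH fN]]]] := Nnear S (a, b) w0 _ _ tau _ clS erho0 rho2.
- by rewrite /diff_proj /= subr0.
- by split.
- rewrite prod_normE/= subr0 normr0 ge_max (ltW erho0) andbT.
  have -> : a - b - (z i0 - z i1) = (a - z i0) - (b - z i1).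
    by rewrite !opprB [LHS]addrACA [RHS]addrACA [- b + _]addrC.
  by apply: le_trans (ler_normB _ _) _; clear -az bz; lra.
- move=> [s1 s2] [/= Fs1 Os2]; rewrite prod_normE/= ge_max => /andP[s1a s2b] /(congr1 fst) js.
  have {}js : s1 - s2 = z i0 - z i1 by [].
  (* If the projection took the value [w0], then [s1 - z i0 = s2 - z i1] would lie in both
     translated sets and in the ball of radius [rho]. *)
  suff : set0 (s1 - z i0) by [].
  rewrite -inter; split.
    move=> i _; have [->|->] : i = i0 \/ i = i1.
      by case: i => -[|[|//]] p; [left|right]; apply: val_inj.
      by exists s1 => //; rewrite B0.
    exists s2; first by rewrite B1.
    have -> : s1 = s2 + (z i0 - z i1) by rewrite -js [RHS]addrC subrK.
    by rewrite -[RHS]addrA; congr (_ + _); rewrite [RHS]addrAC subrr add0r.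
  rewrite -ball_normE /= sub0r normrN.
  have := ler_distD a s1 (z i0); clear -s1a az erho rho0; lra.
- have -> : 48 * (2 * (e' * rho)) / (rho / 2) = 192 * e' by field; rewrite gt_eqF.
  clear -e't; lra.
- by [].
move: w Sw wx fN => [[x1 y1] [x2 y2]] [/= Fw [/= Ox2 Ay2]] wx fN.
have [k [f1 [g1 [f2 [g2 [k0 fg1 [fg2 fg3] fgt fg]]]]]] := normalized_components (ltW tau0) fp H0 fH.
have [N1 N2] := Nprod _ _ _ _ _ _ _ fN.
have [N3 N4] := Nprod _ _ _ _ _ _ _ N2.
have nearb (u v : X * Y) i : ball (xb, yb) e' (z i) -> `|v - z i| < e' * rho ->
    `|u - v| <= rho / 2 -> `|(xb, yb) - u| < e.
  rewrite -ball_normE /= => h1 h2 h3.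
  have := ler_distD (z i) (xb, yb) u; have := ler_distD v (z i) u.
  rewrite (distrC (z i) v) (distrC v u); clear -h1 h2 h3 erho e'e rhoe rho0 e'0; lra.
have wx1 : `|(x1, y1) - a| <= rho / 2.
  exact: le_trans (prod_norm_fst ((x1, y1, (x2, y2)) - (a, b))) wx.
have wx2 : `|(x2, y2) - b| <= rho / 2.
  exact: le_trans (prod_norm_snd ((x1, y1, (x2, y2)) - (a, b))) wx.
have b1 := nearb _ _ _ (zball i0) az wx1; have b2 := nearb _ _ _ (zball i1) bz wx2.
exists x1, y1, x2, A, y2, f1, g1, f2, g2; split => //.
- by split => //; rewrite -ball_normE.
- split=> //; rewrite -ball_normE.
  exact: le_lt_trans (prod_norm_fst ((xb, yb) - (x2, y2))) b2.
- split=> //; rewrite -ball_normE.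
  exact: le_lt_trans (prod_norm_snd ((xb, yb) - (x2, y2))) b2.
split=> //.
- exact: Nscale _ _ _ _ _ _ k0 fg1 N1.
- exact: Nscale _ _ _ _ _ _ k0 fg2 N3.
- exact: Nscale _ _ _ _ _ _ k0 fg3 N4.
- apply: le_lt_trans fgt _; clear -taue e0; lra.
Qed.

(** * Product and scaling rules for the normal cones *)

Section NormalCalculus.
Context {R : realType}.

(** If [u] is tangent to [S] at [a], then [(u, 0)] is tangent to the product: follow [u] and keep
    the second component of the base points. The other factor is symmetric. *)
Lemma clarke_normal_prod (X Y : normedModType R) (S : set X) (T : set Y) a b f :
  clarke_normal (S `*` T) (a, b) f ->
  clarke_normal S a (dual_inl f) /\ clarke_normal T b (dual_inr f).
Proof.
move=> [[/= Sa Tb] fle]; split; split=> // u Tu; apply: fle => z t Sz zc t0 tc.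
- have [||v vu Sv] := Tu (fst \o z) t _ _ t0 tc.
  + by move=> k; exact: (Sz k).1.
  + exact: (cvg_comp _ _ zc (@cvg_fst _ _ _ _ _)).
  + exists (fun k => (v k, 0)); first by apply: cvg_pair => //=; exact: cvg_cst.
    by move=> k; split; [exact: Sv|rewrite /= scaler0 addr0; exact: (Sz k).2].
- have [||v vu Sv] := Tu (snd \o z) t _ _ t0 tc.
  + by move=> k; exact: (Sz k).2.
  + exact: (cvg_comp _ _ zc (@cvg_snd _ _ _ _ _)).
  + exists (fun k => (0, v k)); first by apply: cvg_pair => //=; exact: cvg_cst.
    by move=> k; split; [rewrite /= scaler0 addr0; exact: (Sz k).1|exact: Sv].
Qed.

Lemma clarke_normal_scale (Z : normedModType R) (S : set Z) z (a : R) (f h : dual Z) :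
  0 < a -> (forall x, h x = a * f x) -> clarke_normal S z f -> clarke_normal S z h.
Proof.
move=> a0 hf [Sz fle]; split=> // w Tw; rewrite hf.
by rewrite pmulr_rle0// fle.
Qed.

(** Frechet normality without quotient or upper limit, for which the product and scaling rules are
    immediate. *)
Definition frechet_normal_eps (Z : normedModType R) (S : set Z) z : set (dual Z) :=
  [set f | S z /\ forall e : R, 0 < e -> exists2 d : R, 0 < d & forall s, S s ->
    `|s - z| < d -> f (s - z) <= e * `|s - z|].

Lemma frechet_normal_epsW (Z : normedModType R) (S : set Z) z f :
  frechet_normal_eps S z f -> frechet_normal S z f.
Proof.
move=> [Sz fle]; split=> //; apply/lee_addgt0Pr => e e0; rewrite add0e.
have [d d0 hd] := fle e e0.
pose A := [set s | S s /\ s != z /\ `|s - z| < d].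
apply: le_trans (_ : (ereal_sup [set (f (s - z) / `|s - z|)%:E | s in A] <= _)%E).
  (* The upper limit is an infimum of suprema over punctured neighbourhoods within [S], of which [A]
     is one. *)
  apply: ereal_inf_lbound; exists A => //.
  suff : nbhs z (fun s => s != z -> S s -> A s) by [].
  apply/nbhs_ballP; exists d => //= s; rewrite -ball_normE /= distrC => sd sz Ss.
  by split.
apply: ge_ereal_sup => _ [s [Ss [sz sd]] <-]; rewrite lee_fin ler_pdivrMr.
  exact: hd.
by rewrite normr_gt0 subr_eq0.
Qed.

Lemma frechet_normal_eps_prod (X Y : normedModType R) (S : set X) (T : set Y) a b f :
  frechet_normal_eps (S `*` T) (a, b) f ->
  frechet_normal_eps S a (dual_inl f) /\ frechet_normal_eps T b (dual_inr f).
Proof.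
move=> [[/= Sa Tb] fle]; split; split=> // e e0; have [d d0 hd] := fle e e0;
  exists d => // s Ss sd.
- have sE : (s, b) - (a, b) = (s - a, 0) by rewrite -[LHS]/(s - a, b - b) subrr.
  have nE : `|(s, b) - (a, b)| = `|s - a|.
    by rewrite sE prod_normE/= normr0 max_l.
  by have := hd (s, b) (conj Ss Tb); rewrite nE sE; exact.
- have sE : (a, s) - (a, b) = (0, s - b) by rewrite -[LHS]/(a - a, s - b) subrr.
  have nE : `|(a, s) - (a, b)| = `|s - b|.
    by rewrite sE prod_normE/= normr0 max_r.
  by have := hd (a, s) (conj Sa Ss); rewrite nE sE; exact.
Qed.

Lemma frechet_normal_eps_scale (Z : normedModType R) (S : set Z) z (a : R) (f h : dual Z) :
  0 < a -> (forall x, h x = a * f x) ->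
  frechet_normal_eps S z f -> frechet_normal_eps S z h.
Proof.
move=> a0 hf [Sz fle]; split=> // e e0; have [d d0 hd] := fle _ (divr_gt0 e0 a0).
exists d => // s Ss sz; rewrite hf -ler_pdivlMl//.
by apply: le_trans (hd s Ss sz) _; rewrite mulrA [_ * e]mulrC.
Qed.

End NormalCalculus.

Theorem theorem3p1 (R : realType) (X Y : completeNormedModType R)
    (Omega : set X) (F : X -> set Y) (xb : X) (yb : Y) (Xi : set (set Y)) :
  Omega xb -> F xb yb -> Xi !=set0 ->
  closed Omega -> closed (gph F) -> (forall A, Xi A -> closed A) ->
  triple_approx_stationary F Omega Xi xb yb ->
  (forall e : R, 0 < e ->
     exists (x1 : X) (y1 : Y) (x2 : X) (A : set Y) (y2 : Y)
            (f1 : dual X) (g1 : dual Y) (f2 : dual X) (g2 : dual Y),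
       [/\ gph F (x1, y1) /\ ball (xb, yb) e (x1, y1),
           Omega x2 /\ ball xb e x2,
           Xi A,
           A y2 /\ ball yb e y2 &
           [/\ clarke_normal (gph F) (x1, y1) (dual_pair f1 g1),
               clarke_normal Omega x2 f2,
               clarke_normal A y2 g2,
               pair_norm (f1 \+ f2) (g1 \+ g2) < e &
               pair_norm f1 g1 + pair_norm f2 g2 = 1]]) /\
  (asplund X -> asplund Y -> forall e : R, 0 < e ->
     exists (x1 : X) (y1 : Y) (x2 : X) (A : set Y) (y2 : Y)
            (f1 : dual X) (g1 : dual Y) (f2 : dual X) (g2 : dual Y),
       [/\ gph F (x1, y1) /\ ball (xb, yb) e (x1, y1),
           Omega x2 /\ ball xb e x2,
           Xi A,
           A y2 /\ ball yb e y2 &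
           [/\ frechet_normal (gph F) (x1, y1) (dual_pair f1 g1),
               frechet_normal Omega x2 f2,
               frechet_normal A y2 g2,
               pair_norm (f1 \+ f2) (g1 \+ g2) < e &
               pair_norm f1 g1 + pair_norm f2 g2 = 1]]).
Proof.

move=> _ _ _ cO cF cA stat.
have cW : @seq_complete R ((X * Y) * (X * Y))%type.
  by do 2 apply: seq_complete_prod; exact: complete_seq_complete.
split=> [e e0|aX aY e e0].
  apply: (stationary_normals (N := fun Z => @clarke_normal R Z) _ _ _ cO cF cA stat e0).
  - exact: clarke_normal_prod.
  - exact: clarke_normal_scale.
  - move=> S x0 w0 e' l tau Jw0 clS.
    exact: (clarke_normal_near diff_proj_idem diff_proj_bound Jw0 cW clS).
have dW : dual_separable ((X * Y) * (X * Y))%type.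
  by do 2 apply: dual_separable_prod; exact: asplund_dual_separable.
have [|||x1 [y1 [x2 [A [y2 [f1 [g1 [f2 [g2 [h1 h2 h3 h4 [n1 n2 n3 n4 n5]]]]]]]]]]] :=
  stationary_normals (N := @frechet_normal_eps R) _ _ _ cO cF cA stat e0.
- exact: frechet_normal_eps_prod.
- exact: frechet_normal_eps_scale.
- move=> S x0 w0 e' l tau Jw0 clS e'0 l0 Sx0 x0e Jne et tau1.
  have [w [f [H [wS fp H0 fH fe]]]] := frechet_normal_near diff_proj_idem diff_proj_bound
    Jw0 cW dW clS e'0 l0 Sx0 x0e Jne et tau1.
  by exists w, f, H; split=> //; split=> //; case: wS.
exists x1, y1, x2, A, y2, f1, g1, f2, g2; split=> //.
by split=> //; exact: frechet_normal_epsW.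
Qed.
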